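(* Let $M\ge0$ be real. Let $1\le\rho<2$, $\frac1\rho+\frac1{\rho'}=1$, $1<p<\rho'$ and $\frac1q=\frac1p-\frac1{\rho'}$. There is a constant $C_M$ (independent of $f$ and $t$) such that for every $f\in C^2(\mathbb R\times[0,\infty))$ with $f(\cdot,t)\in C_0^\infty(\mathbb R)$ for each $t$, the solution $u=u(x,t)$ of the Cauchy problem $$u_{tt}-e^{-2t}u_{xx}+M^2u=f(x,t),\quad t>0,\ x\in\mathbb R,\qquad u(x,0)=u_t(x,0)=0,$$ satisfies, for all $t>0$, $$\|u(\cdot,t)\|_{L^q(\mathbb R)}\le C_M\,e^{t(1-1/\rho)}\int_0^t(1+t-b)\,(e^{t-b}-1)^{1/\rho}(e^{t-b}+1)^{-1}\,\|f(\cdot,b)\|_{L^p(\mathbb R)}\,db .$$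
   Context: Convention: $\rho'=\infty$ and $1/\rho'=0$ when $\rho=1$. *)

(* Defs.v *)
From mathcomp Require Import all_boot all_order all_algebra.
From mathcomp Require Import all_classical all_reals all_analysis.
Set Implicit Arguments.
Unset Strict Implicit.
Unset Printing Implicit Defensive.
Import Order.TTheory GRing.Theory Num.Theory.
Import numFieldNormedType.Exports.

Local Open Scope classical_set_scope.
Local Open Scope ring_scope.

(* Functions on R x [0, +oo[ are represented by g : R -> R -> R, with g x t the
   value at position x and time t; values at t < 0 are junk, and nothing below
   depends on them. *)

Definition half_plane {R : realType} : set (R * R) := [set z | 0 <= z.2].

(* l is the t-derivative of g at (x, t) relative to [0, +oo[: the ordinary
   partial derivative for 0 < t, the right derivative for t = 0. *)
Definition is_dt {R : realType} (g : R -> R -> R) (x t l : R) : Prop :=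
  (g x s - g x t) / (s - t) @[s --> within [set s | 0 <= s] t^'] --> l.

Fixpoint Ck_half_plane {R : realType} (k : nat) (g : R -> R -> R) : Prop :=
  {within half_plane, continuous (fun z : R * R => g z.1 z.2)} /\
  if k is k'.+1 then
    exists gx gt : R -> R -> R,
      [/\ forall x t : R, 0 <= t -> is_derive x 1 (g^~ t) (gx x t),
          forall x t : R, 0 <= t -> is_dt g x t (gt x t),
          Ck_half_plane k' gx
        & Ck_half_plane k' gt]
  else True.

Definition smooth_compact_support {R : realType} (g : R -> R) : Prop :=
  (forall (n : nat) (x : R), derivable (g^`(n))%classic x 1) /\
  compact (closure [set x | g x != 0]).

(* Classical solutions, of class C^2 up to the boundary t = 0.  For 0 < t the
   second derivatives in the equation only involve values of u at positive
   times. *)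
Definition is_cauchy_solution {R : realType} (M : R) (f u : R -> R -> R) : Prop :=
  [/\ Ck_half_plane 2 u,
      forall x t : R, 0 < t ->
        (u x)^`(2)%classic t - expR (- (2 * t)) * (u^~ t)^`(2)%classic x
          + M ^+ 2 * u x t = f x t,
      forall x : R, u x 0 = 0
    & forall x : R, is_dt u x 0 0].

(* Main.v *)
Require Import Defs.
From mathcomp Require Import all_boot all_order all_algebra.
From mathcomp Require Import all_classical all_reals all_analysis.
From mathcomp Require Import measurable_realfun.
From mathcomp Require Import ring lra.
Import Order.TTheory GRing.Theory Num.Theory.
Import numFieldNormedType.Exports.
Local Open Scope classical_set_scope.
Local Open Scope ring_scope.
Set Implicit Arguments.
Unset Strict Implicit.
Unset Printing Implicit Defensive.

(* In the variable s = e^{-t} the backward characteristic cone of (x0, t0) is the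
   triangle |x - x0| <= e^{-t} - e^{-t0}, and the Riemann function with pole
   (x0, t0) is e^{(t+t0)/2} P(Z), where P is the Legendre function of degree
   -1/2 + iM, normalised by P(1) = 1, and Z is the hyperbolic distance variable.
   Green's formula on the triangle gives Duhamel's formula for u.  An energy
   argument for the Legendre equation gives |P(Z)| <= C (1 + ln Z) Z^{-1/2}; the
   kernel at time t is thus at most (1 + t0 - t) times an explicit function of
   x - x0 whose power rho is integrable exactly because rho < 2.  The estimate is
   then Young's convolution inequality combined with Minkowski's: testing against
   |u|^{q-1}, both follow from a pointwise weighted AM-GM inequality and Tonelli. *)

(** * Power series of radius at least one *)

(** The degree -1/2 + iM is complex, but the Legendre equation contains only the real number M^2 +
    1/4, so P is built over the reals. A series in Z - 1 would stop at distance 2, because of the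
    singular point Z = -1; one in (Z - 1) / (Z + 1) covers all Z > 0. The triangle is rescaled to a
    rectangle by x = x0 + (e^{-t} - e^{-t0}) y, so that Green's formula needs only Fubini and the
    one-variable fundamental theorem, and only an inequality for |u| is extracted from it. The L^q
    norm of u is not known to be finite a priori, yet a power of it has to be cancelled. Hence x is
    confined to a compact interval until the very end. The exponent rho' enters only through 1/rho'
    = 1 - 1/rho, a real number, so rho = 1 is no separate case. The weight arises as follows: the
    kernel to the power rho has mass at most a constant times (e^{-t} - e^{-t0}) e^{rho t} over a
    section of the cone, up to the logarithmic factor; take the root of order rho and use e^t <= 2
    e^{t0} / (e^{t0-t} + 1). *)

Section Tempered.
Context {R : realType}.
Implicit Types (a b : R^nat) (x : R).

(** Radius of convergence at least 1, put as a growth bound on the coefficients: in this form it can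
    be proved by induction along a recurrence, and it survives shifts and differentiation. *)
Definition tempered a := forall B : R, 1 < B -> exists C : R, forall n, `|a n| <= C * B ^+ n.

Lemma tempered_cvg a x : tempered a -> `|x| < 1 -> cvgn (pseries a x).
Proof.
move=> ta x1; have x0 := normr_ge0 x.
have [B B1 Bx] : exists2 B : R, 1 < B & B * `|x| < 1.
  exists (2 / (1 + `|x|)); first by rewrite ltr_pdivlMr; lra.
  by rewrite mulrAC ltr_pdivrMr; lra.
have [C HC] := ta B B1.
have C0 : 0 <= C by have := HC 0%N; rewrite expr0 mulr1; apply: le_trans.
apply: normed_cvg.
apply: (@series_le_cvg _ _ (geometric C (B * `|x|))) => [n|n|n|].
- exact: normr_ge0.
- by rewrite /geometric /= mulr_ge0 // exprn_ge0 // mulr_ge0 // ltW // (lt_trans _ B1).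
- rewrite /geometric /= normrM normrX exprMn mulrA ler_wpM2r // exprn_ge0 //.
- apply: is_cvg_geometric_series.
  by rewrite ger0_norm // mulr_ge0 // ltW // (lt_trans _ B1).
Qed.

(** Half of the growth is spent on the extra factor: with B = s^2, Bernoulli gives n + 1 <= s^(n+1)
    / (s - 1), and the coefficient itself is bounded with base s. *)
Lemma tempered_diffs a : tempered a -> tempered (pseries_diffs a).
Proof.
move=> ta B B1.
pose s := Num.sqrt B.
have s0 : 0 <= s by exact: sqrtr_ge0.
have ss : s * s = B by rewrite -expr2 sqr_sqrtr //; lra.
have s1 : 1 < s by nra.
have [C HC] := ta s s1.
have C0 : 0 <= C by have := HC 0%N; rewrite expr0 mulr1; apply: le_trans.
have bern n : n%:R * (s - 1) <= s ^+ n.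
  elim: n => [|n IH]; first by rewrite mul0r expr0.
  have : 1 <= s ^+ n by rewrite exprn_ege1 // ltW.
  rewrite exprS -natr1; nra.
exists (C * s * (s / (s - 1))) => n.
rewrite /pseries_diffs normrM ger0_norm //.
apply: (@le_trans _ _ ((s ^+ n.+1 / (s - 1)) * (C * s ^+ n.+1))).
  apply: ler_pM => //; rewrite ler_pdivlMr ?subr_gt0 //.
by rewrite -ss exprMn !exprS le_eqVlt; apply/orP; left; apply/eqP; field; lra.
Qed.

Lemma pseries_shift a x : tempered (fun n => a n.+1) -> `|x| < 1 ->
  limn (pseries a x) = a 0%N + x * limn (pseries (fun n => a n.+1) x).
Proof.
move=> ta x1; have cv := tempered_cvg ta x1.
apply/cvg_lim => //; rewrite -cvg_shiftS.
have -> : [sequence pseries a x n.+1]_n =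
          (fun n => a 0%N + x * pseries (fun n => a n.+1) x n).
  apply/funext => n; rewrite /pseries /series /= big_nat_recl // expr0 mulr1.
  by congr (_ + _); rewrite mulr_sumr; apply: eq_bigr => i _; rewrite exprS; ring.
by apply: cvgD; [exact: cvg_cst|apply: cvgM => //; exact: cvg_cst].
Qed.

Lemma pseries_lin a b k x : tempered a -> tempered b -> `|x| < 1 ->
  limn (pseries (fun n => a n + k * b n) x) =
  limn (pseries a x) + k * limn (pseries b x).
Proof.
move=> ta tb x1; apply/cvg_lim => //.
have -> : pseries (fun n => a n + k * b n) x =
          (fun n => pseries a x n + k * pseries b x n).
  apply/funext => n; rewrite /pseries /series /= mulr_sumr -big_split /=.
  by apply: eq_bigr => i _; ring.
apply: cvgD; first exact: tempered_cvg.
by apply: cvgM; [exact: cvg_cst|exact: tempered_cvg].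
Qed.

Lemma is_derive_pseries a x : tempered a -> `|x| < 1 ->
  is_derive x 1 (fun y => limn (pseries a y)) (limn (pseries (pseries_diffs a) x)).
Proof.
move=> ta x1; have K1 : `|(1 + `|x|) / 2| < 1.
  by rewrite ger0_norm; have := normr_ge0 x; lra.
apply: (@pseries_snd_diffs _ _ ((1 + `|x|) / 2)).
- exact: tempered_cvg.
- by apply: tempered_cvg => //; exact: tempered_diffs.
- by apply: tempered_cvg => //; exact/tempered_diffs/tempered_diffs.
- by rewrite [ltRHS]ger0_norm; have := normr_ge0 x; lra.
Qed.

Lemma pseries_at0 a : limn (pseries a 0) = a 0%N.
Proof.
apply/cvg_lim => //; rewrite -cvg_shiftS.
rewrite (_ : [sequence _]_n = cst (a 0%N)); first exact: cvg_cst.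
apply/funext => n; rewrite /pseries /series /= big_nat_recl // expr0 mulr1 big1 ?addr0 //.
by move=> i _; rewrite exprS mul0r mulr0.
Qed.

End Tempered.

(** * Derivatives and continuity *)

Section Calculus.
Context {R : realType}.
Implicit Types (f g : R -> R) (x a b : R).

Lemma is_derive_conv f x a b : is_derive x 1 f a -> a = b -> is_derive x 1 f b.
Proof. by move=> ? <-. Qed.

Lemma der_cst (c x : R) : is_derive x 1 (fun _ : R => c) 0.
Proof. exact: is_derive_cst. Qed.

Lemma der_id x : is_derive x 1 (fun y : R => y) 1.
Proof. exact: is_derive_id. Qed.

Lemma derD f g x a b : is_derive x 1 f a -> is_derive x 1 g b ->
  is_derive x 1 (fun y => f y + g y) (a + b).
Proof. by move=> ? ?; exact: is_deriveD. Qed.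

Lemma derN f x a : is_derive x 1 f a -> is_derive x 1 (fun y => - f y) (- a).
Proof. by move=> ?; exact: is_deriveN. Qed.

Lemma derM f g x a b : is_derive x 1 f a -> is_derive x 1 g b ->
  is_derive x 1 (fun y => f y * g y) (a * g x + f x * b).
Proof.
move=> df dg; apply: is_derive_eq (is_deriveM df dg) _.
by rewrite /GRing.scale /=; ring.
Qed.

Lemma derX f n x a : is_derive x 1 f a ->
  is_derive x 1 (fun y => f y ^+ n.+1) (n.+1%:R * f x ^+ n * a).
Proof.
move=> df; elim: n => [|n IH].
  by notypeclasses refine (is_derive_conv df _); rewrite expr0 mulr1 mul1r.
rewrite (_ : (fun y => _) = (fun y => f y * f y ^+ n.+1)); last first.
  by apply/funext => y; rewrite exprS.
by notypeclasses refine (is_derive_conv (derM df IH) _); rewrite exprS -[in RHS]natr1; ring.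
Qed.

Lemma derV f x a : is_derive x 1 f a -> f x != 0 ->
  is_derive x 1 (fun y => (f y)^-1) (- a / f x ^+ 2).
Proof.
move=> df f0; apply: is_derive_eq (is_deriveV f0 df) _.
by rewrite /GRing.scale /= mulNr mulrC mulNr.
Qed.

Lemma der_comp f g x a b : is_derive (g x) 1 f a -> is_derive x 1 g b ->
  is_derive x 1 (fun y => f (g y)) (a * b).
Proof. by move=> ? ?; exact: is_derive1_comp. Qed.

Lemma der_expR f x a : is_derive x 1 f a ->
  is_derive x 1 (fun y => expR (f y)) (expR (f x) * a).
Proof. by move=> df; apply: der_comp => //; exact: is_derive_expR. Qed.

Lemma is_derive_continuous f x a : is_derive x 1 f a -> {for x, continuous f}.
Proof. by case=> df _; apply/differentiable_continuous/derivable1_diffP. Qed.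

Lemma is_derive_near f g x a : (\forall y \near x, f y = g y) ->
  is_derive x 1 f a -> is_derive x 1 g a.
Proof. exact: near_eq_is_derive. Qed.

End Calculus.

(* [notypeclasses refine] keeps the library instances, whose derivatives are
   stated pointfree, from resolving the subgoals first. *)
Ltac der_step := first
  [ eassumption | notypeclasses refine (der_cst _ _) | notypeclasses refine (der_id _)
  | notypeclasses refine (derD _ _) | notypeclasses refine (derN _)
  | notypeclasses refine (derM _ _) | notypeclasses refine (derX _ _)
  | notypeclasses refine (der_expR _) | notypeclasses refine (derV _ _) ].
Ltac solve_is_derive tac := notypeclasses refine (is_derive_conv _ _); [repeat der_step|cbv beta; tac].

Section Continuity.
Context {R : realType} {T : topologicalType}.
Implicit Types (f g : T -> R) (x : T).

Lemma cont_cst (c : R) : continuous (fun _ : T => c).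
Proof. by move=> x; exact: cvg_cst. Qed.

Lemma contD f g : continuous f -> continuous g -> continuous (fun y => f y + g y).
Proof. by move=> cf cg x; apply: cvgD; [exact: cf|exact: cg]. Qed.

Lemma contN f : continuous f -> continuous (fun y => - f y).
Proof. by move=> cf x; apply: cvgN; exact: cf. Qed.

Lemma contM f g : continuous f -> continuous g -> continuous (fun y => f y * g y).
Proof. by move=> cf cg x; apply: cvgM; [exact: cf|exact: cg]. Qed.

Lemma contX f n : continuous f -> continuous (fun y => f y ^+ n).
Proof.
move=> cf; elim: n => [|n IH]; first exact: cont_cst.
by under eq_fun do rewrite exprS; exact: contM.
Qed.

Lemma contV f : (forall x, f x != 0) -> continuous f -> continuous (fun y => (f y)^-1).
Proof. by move=> f0 cf x; apply: cvgV => //; exact: cf. Qed.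

Lemma cont_norm f : continuous f -> continuous (fun y => `|f y|).
Proof. by move=> cf x; apply: cvg_norm; exact: cf. Qed.

Lemma cont_comp (h : R -> R) f : continuous h -> continuous f -> continuous (fun y => h (f y)).
Proof. by move=> ch cf x; apply: continuous_comp; [exact: cf|exact: ch]. Qed.

Lemma cont_expR f : continuous f -> continuous (fun y => expR (f y)).
Proof. by apply: cont_comp; exact: continuous_expR. Qed.

Lemma cont_max f g : continuous f -> continuous g -> continuous (fun y => Num.max (f y) (g y)).
Proof. by move=> cf cg x; apply: continuous_max; [exact: cf|exact: cg]. Qed.

End Continuity.

(** * The Legendre function *)

Section Legendre.
Context {R : realType}.
Variables (l : R) (l0 : 0 <= l).

(** The a_n are the coefficients of P in the variable x = (Z - 1) / (Z + 1), where the equation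
    reads (1 - x)^2 (x phi')' + l phi = 0. The recurrence this gives for a has order two; carrying
    c_n = n^2 a_n and its difference d_n = c_n - c_{n-1} makes it a one-step recursion. *)
Fixpoint leg_state n : R * R * R :=
  if n is m.+1 then
    let: (a, c, d) := leg_state m in
    let d' := d - l * a in let c' := c + d' in (c' / m.+1%:R ^+ 2, c', d')
  else (1, 0, 0).
Let a n := (leg_state n).1.1.
Let c n := (leg_state n).1.2.
Let d n := (leg_state n).2.

Let dS n : d n.+1 = d n - l * a n.
Proof. by rewrite /d /a /=; case: (leg_state n) => [[]]. Qed.
Let cS n : c n.+1 = c n + d n.+1.
Proof. by rewrite dS /c /d /a /=; case: (leg_state n) => [[]]. Qed.
Let aS n : a n.+1 = c n.+1 / n.+1%:R ^+ 2.
Proof. by rewrite cS dS /c /d /a /=; case: (leg_state n) => [[]]. Qed.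
Let a0 : a 0%N = 1. Proof. by []. Qed.
Let c0 : c 0%N = 0. Proof. by []. Qed.
Let d0 : d 0%N = 0. Proof. by []. Qed.

Let aSn n : `|a n.+1| * n.+1%:R = `|c n.+1| / n.+1%:R.
Proof.
rewrite aS normrM normfV (ger0_norm (exprn_ge0 _ _)) //.
by field; rewrite nat1r pnatr_eq0.
Qed.

(** Since n |a_n| = |c_n| / n <= C B^n, the increment l |a_n| of d is at most (B - 1) C B^n as soon
    as l <= (B - 1) n, which closes the induction beyond [N]. The constant [C] absorbs the finitely
    many earlier terms. *)
Let leg_growth (B : R) : 1 < B -> exists2 C : R, 1 <= C & forall n,
  `|d n| <= C * B ^+ n /\ `|c n| <= n%:R * (C * B ^+ n).
Proof.
move=> B1; have B0 : 0 < B by lra.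
pose N := (Num.truncn (l / (B - 1))).+1.
have hN n : (N <= n)%N -> l <= (B - 1) * n%:R.
  move=> Nn; rewrite mulrC -ler_pdivrMr ?subr_gt0 //.
  apply: (@le_trans _ _ N%:R); last by rewrite ler_nat.
  by apply/ltW/truncnS_gt.
have B1n n : 1 <= B ^+ n by rewrite exprn_ege1 // ltW.
pose C := 1 + \sum_(i < N.+1) (`|d i| + `|c i|).
have C1 : 1 <= C by rewrite lerDl sumr_ge0.
have small n : (n <= N)%N -> `|d n| <= C /\ `|c n| <= C.
  move=> nN; rewrite /C (bigD1 (Ordinal (nN : (n < N.+1)%N))) //=.
  set s := \sum_(_ < _ | _) _; have s0 : 0 <= s by rewrite sumr_ge0.
  by have := normr_ge0 (d n); have := normr_ge0 (c n); lra.
exists C => //; elim=> [|n IH]; first by rewrite d0 c0 normr0 mul0r expr0; lra.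
have [nN|Nn] := leqP n.+1 N.
  have [dn cn] := small _ nN; have := B1n n.+1 => Bn.
  have n1 : 1 <= n.+1%:R :> R by rewrite ler1n.
  have CB : C <= C * B ^+ n.+1 by rewrite ler_peMr //; lra.
  split; first by lra.
  by apply: (le_trans (le_trans cn CB)); rewrite ler_peMl //; lra.
have {}Nn : (N <= n)%N by [].
have npos : 0 < n%:R :> R by rewrite ltr0n (leq_trans _ Nn).
have [dn cn] := IH.
have ln := hN n Nn.
have CBn : 1 <= C * B ^+ n by have := B1n n; nra.
have dS' : `|d n.+1| <= C * B ^+ n.+1.
  rewrite dS; apply: (le_trans (ler_normB _ _)); rewrite normrM (ger0_norm l0).
  have an : `|a n| * n%:R <= C * B ^+ n.
    case: n npos cn {Nn dn CBn ln IH} => [|n] npos cn; first by move: npos; rewrite ltxx.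
    by rewrite aSn ler_pdivrMr // mulrC.
  rewrite exprS.
  have := normr_ge0 (a n); set u := `|a n| in an *; set v := C * B ^+ n in an dn cn CBn *.
  rewrite (_ : C * (B * B ^+ n) = B * v); last by rewrite /v; ring.
  move=> u0; have : l * u <= (B - 1) * v; last by lra.
  apply: (@le_trans _ _ ((B - 1) * n%:R * u)); first by rewrite ler_wpM2r.
  by rewrite -mulrA ler_wpM2l ?subr_ge0 ?(ltW B1) // mulrC.
split => //; rewrite cS; apply: (le_trans (ler_normD _ _)).
have Bv : C * B ^+ n <= C * B ^+ n.+1.
  by rewrite ler_wpM2l ?exprS ?ler_peMl ?exprn_ge0 //; lra.
rewrite -natr1 mulrDl mul1r; apply: lerD => //.
by apply: (le_trans cn); rewrite ler_wpM2l.
Qed.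

Let ta : tempered a.
Proof.
move=> B B1; have [C C1 HC] := leg_growth B1; exists C => -[|n].
  by rewrite a0 normr1 expr0 mulr1.
have [_ h] := HC n.+1; rewrite aS normrM normfV (ger0_norm (exprn_ge0 _ _)) //.
rewrite ler_pdivrMr ?exprn_gt0 //; apply: (le_trans h).
rewrite mulrC ler_wpM2l //.
  by rewrite mulr_ge0 ?exprn_ge0 //; lra.
by rewrite expr2 ler_peMl // ler1n.
Qed.

Let td : tempered d.
Proof. by move=> B B1; have [C C1 HC] := leg_growth B1; exists C => n; case: (HC n). Qed.

Let temperedS (u : R^nat) : tempered u -> tempered (fun n => u n.+1).
Proof.
move=> tu B B1; have [C HC] := tu B B1; exists (C * B) => n.
by rewrite -mulrA -exprS.
Qed.

Let tempered_unshift (u : R^nat) : tempered (fun n => u n.+1) -> tempered u.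
Proof.
move=> tu B B1; have [C HC] := tu B B1.
have B0 : 0 < B by lra.
exists (`|u 0%N| + C / B) => -[|n].
  rewrite expr0 mulr1 lerDl divr_ge0 ?(ltW B0) //.
  by have := HC 0%N; rewrite expr0 mulr1; apply: le_trans.
apply: (le_trans (HC n)); rewrite mulrDl exprS.
rewrite [X in _ <= _ + X](_ : _ = C * B ^+ n); last by field; lra.
by rewrite lerDr !mulr_ge0 ?exprn_ge0 ?(ltW B0).
Qed.

Let phi k (x : R) := limn (pseries (iter k (@pseries_diffs R) a) x).

Let tphi k : tempered (iter k (@pseries_diffs R) a).
Proof. by elim: k => [|k IH] /=; [exact: ta|exact: tempered_diffs]. Qed.

Let dphi k (x : R) : `|x| < 1 -> is_derive x 1 (phi k) (phi k.+1 x).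
Proof. by move=> x1; exact: is_derive_pseries. Qed.

(* Coefficientwise the equation reads c_{n+1} = (n+1)^2 a_{n+1}, and each factor
   1 - x takes one difference: c_{n+1} - c_n = d_{n+1}, d_{n+1} - d_n = - l a_n. *)
Let phi_ode (x : R) : `|x| < 1 ->
  (1 - x) ^+ 2 * (phi 1 x + x * phi 2 x) + l * phi 0 x = 0.
Proof.
move=> x1.
(* The coefficients n (n+1) a_{n+1} of x phi''; adding those of phi' gives (n+1)^2 a_{n+1} =
   c_{n+1}. *)
pose e n := n%:R * pseries_diffs a n.
have eS : (fun n => e n.+1) = iter 2 (@pseries_diffs R) a by [].
have te : tempered e by apply: tempered_unshift; rewrite eS; exact: (tphi 2).
have cE : (fun n => c n.+1) = (fun n => pseries_diffs a n + 1 * e n).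
  apply/funext => n; rewrite /e /pseries_diffs aS mul1r -[in RHS]natr1.
  by field; rewrite natr1 pnatr_eq0.
have phi12 : phi 1 x + x * phi 2 x = limn (pseries (fun n => c n.+1) x).
  rewrite cE pseries_lin //; last exact: (tphi 1).
  have te' : tempered (fun n => e n.+1) := tphi 2.
  have e0 : e 0%N = 0 by rewrite /e mulr0n mul0r.
  by rewrite mul1r (pseries_shift te') // e0 add0r.
have tcS : tempered (fun n => c n.+1).
  have t1 := tphi 1; move=> B B1; have [C HC] := t1 B B1; have [C' HC'] := te B B1.
  exists (C + C') => n; move/(congr1 (@^~ n)): cE => ->; rewrite mul1r mulrDl.
  by apply: (le_trans (ler_normD _ _)); apply: lerD; [exact: HC|exact: HC'].
have step (u v : R^nat) (k : R) : u 0%N = 0 -> tempered (fun n => u n.+1) -> tempered v ->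
    (forall n, u n.+1 = u n + k * v n) ->
    (1 - x) * limn (pseries (fun n => u n.+1) x) = k * limn (pseries v x).
  move=> u0 tu tv uS; have tu' := tempered_unshift tu.
  have := pseries_shift tu x1; rewrite u0 add0r => h.
  have := pseries_lin k tu' tv x1; rewrite -(funext uS) h => e1.
  by rewrite mulrBl mul1r {1}e1; ring.
have tdS := temperedS td.
have s1 : (1 - x) * limn (pseries (fun n => c n.+1) x) = 1 * limn (pseries (fun n => d n.+1) x).
  by apply: step => // n; rewrite cS mul1r.
have s2 : (1 - x) * limn (pseries (fun n => d n.+1) x) = - l * limn (pseries a x).
  by apply: step => // n; rewrite dS mulNr.
rewrite phi12 expr2 -mulrA s1 mul1r s2 /phi /=; ring.
Qed.

(** Maps Z > 0 into |x| < 1 and the singular point Z = 1 to the centre x = 0, so a single power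
    series gives the solution regular at Z = 1 on the whole range Z >= 1. *)
Let zz (Z : R) := (Z - 1) / (Z + 1).

Let zz1 (Z : R) : 0 < Z -> `|zz Z| < 1.
Proof.
by move=> Z0; rewrite /zz ltr_norml ltr_pdivrMr ?ltr_pdivlMr; lra.
Qed.

Let dzz (Z : R) : 0 < Z -> is_derive Z 1 zz (2 / (Z + 1) ^+ 2).
Proof.
move=> Z0; have Z1 : Z + 1 != 0 by lra.
by rewrite /zz; solve_is_derive ltac:(field).
Qed.

Let dphiz k (Z : R) : 0 < Z ->
  is_derive Z 1 (fun Z => phi k (zz Z)) (phi k.+1 (zz Z) * (2 / (Z + 1) ^+ 2)).
Proof. by move=> Z0; apply: der_comp; [exact/dphi/zz1|exact: dzz]. Qed.

Let raw0 Z := phi 0 (zz Z).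
Let raw1 Z := phi 1 (zz Z) * 2 * (Z + 1)^-1 ^+ 2.
Let raw2 Z := phi 2 (zz Z) * 4 * (Z + 1)^-1 ^+ 4 - phi 1 (zz Z) * 4 * (Z + 1)^-1 ^+ 3.

Let draw0 (Z : R) : 0 < Z -> is_derive Z 1 raw0 (raw1 Z).
Proof.
move=> Z0; have Z1 : Z + 1 != 0 by lra.
by apply: is_derive_eq (dphiz 0 Z0) _; rewrite /raw1; field.
Qed.

Let draw1 (Z : R) : 0 < Z -> is_derive Z 1 raw1 (raw2 Z).
Proof.
move=> Z0; have Z1 : Z + 1 != 0 by lra.
have h := dphiz 1 Z0.
by rewrite /raw1 /raw2; solve_is_derive ltac:(field).
Qed.

Let craw2 (Z : R) : 0 < Z -> {for Z, continuous raw2}.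
Proof.
move=> Z0; have Z1 : Z + 1 != 0 by lra.
have h1 := dphiz 1 Z0; have h2 := dphiz 2 Z0.
by rewrite /raw2; notypeclasses refine (is_derive_continuous _); repeat der_step.
Qed.

Let raw_ode (Z : R) : 0 < Z -> (Z ^+ 2 - 1) * raw2 Z + 2 * Z * raw1 Z + l * raw0 Z = 0.
Proof.
move=> Z0; have Z1 : Z + 1 != 0 by lra.
rewrite -(phi_ode (zz1 Z0)) /raw0 /raw1 /raw2 -/(zz Z).
by rewrite {5 6 7}/zz; field.
Qed.

(* Cutting off at Z = 1/2 makes the three functions globally continuous. *)
Let cut (g : R -> R) Z := g (Num.max Z (2^-1)).

Let cut_cont (g : R -> R) : (forall Z : R, 0 < Z -> {for Z, continuous g}) -> continuous (cut g).
Proof.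
move=> cg Z; apply: continuous_comp; last by apply: cg; rewrite lt_max invr_gt0 ltr0n orbT.
have cm : continuous (fun y : R => Num.max y 2^-1).
  by apply: cont_max; [move=> ?; exact: cvg_id|exact: cont_cst].
exact: cm.
Qed.

Let cut_der g (g' Z : R) : 2^-1 < Z -> is_derive Z 1 g g' -> is_derive Z 1 (cut g) g'.
Proof.
move=> Z0; apply: is_derive_near.
have : \forall y \near Z, 2^-1 < y by exact: (@open_gt _ _ Z).
by apply: filterS => y /ltW y0; rewrite /cut max_l.
Qed.

(** The range Z > 1/2 keeps the value Z = 1, taken on the sides of the cone, in the interior, so
    derivatives there are two-sided. Continuity is global because Green's formula below is stated
    for functions continuous on the whole plane. *)
Lemma legendre_exists : exists p0 p1 p2 : R -> R,
  [/\ continuous p0, continuous p1, continuous p2, p0 1 = 1 &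
   forall Z : R, 2^-1 < Z ->
     [/\ is_derive Z 1 p0 (p1 Z), is_derive Z 1 p1 (p2 Z) &
      (Z ^+ 2 - 1) * p2 Z + 2 * Z * p1 Z + l * p0 Z = 0]].
Proof.
exists (cut raw0), (cut raw1), (cut raw2); split.
- by apply: cut_cont => Z Z0; exact: is_derive_continuous (draw0 Z0).
- by apply: cut_cont => Z Z0; exact: is_derive_continuous (draw1 Z0).
- exact: cut_cont.
- rewrite /cut max_l; last by lra.
  by rewrite /raw0 /zz subrr mul0r /phi pseries_at0.
move=> Z Z2; have Z0 : 0 < Z by lra.
have cutE g : cut g Z = g Z by rewrite /cut max_l // ltW.
by rewrite !cutE; split; [apply: cut_der => //; exact: draw0
  |apply: cut_der => //; exact: draw1|exact: raw_ode].
Qed.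

End Legendre.

Ltac nonneg := repeat first
  [ assumption | by apply: ltW | exact: sqr_ge0 | exact: normr_ge0 | exact: sqrtr_ge0
  | exact: powR_ge0 | exact: expR_ge0 | exact: ler0n | exact: ler01
  | apply: addr_ge0 | apply: mulr_ge0 | apply: exprn_ge0 | rewrite invr_ge0 ].

(** * Growth of the Legendre function at infinity *)

Section LegendreBound.
Context {R : realType}.

Lemma derivative_le0_le (f f' : R -> R) (a b : R) : a <= b ->
  (forall x, a <= x <= b -> is_derive x 1 f (f' x)) ->
  (forall x, a <= x <= b -> f' x <= 0) -> f b <= f a.
Proof.
move=> ab df f0.
have dfo x : x \in `]a, b[%R -> is_derive x 1 f (f' x).
  by rewrite in_itv /= => /andP[/ltW ? /ltW ?]; apply: df; apply/andP.
have cf : {within `[a, b], continuous f}.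
  apply: continuous_in_subspaceT => x; rewrite inE /= in_itv /= => xab.
  exact: is_derive_continuous (df _ xab).
have [c cab e] := MVT_segment ab dfo cf.
by rewrite -subr_le0 e mulr_le0_ge0 ?subr_ge0 // f0.
Qed.

Variables (M : R) (p0 p1 p2 : R -> R).
Hypothesis cp0 : continuous p0.
Hypothesis legp : forall Z : R, 2^-1 < Z ->
  [/\ is_derive Z 1 p0 (p1 Z), is_derive Z 1 p1 (p2 Z) &
      (Z ^+ 2 - 1) * p2 Z + 2 * Z * p1 Z + (M ^+ 2 + 4^-1) * p0 Z = 0].

Let S (Z : R) := Num.sqrt (Z ^+ 2 - 1).
Let SS (Z : R) : 2 <= Z -> S Z ^+ 2 = Z ^+ 2 - 1.
Proof. by move=> Z2; rewrite sqr_sqrtr //; nra. Qed.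
Let Spos (Z : R) : 2 <= Z -> 0 < S Z.
Proof. by move=> Z2; rewrite sqrtr_gt0; nra. Qed.
Let Sge (Z : R) : 2 <= Z -> Z / 2 <= S Z.
Proof.
move=> Z2; have := SS Z2; have := Spos Z2; set s := S Z => s0 ss; nra.
Qed.

Let dS (Z : R) : 2 <= Z -> is_derive Z 1 S (Z / S Z).
Proof.
move=> Z2; have Z1 : 0 < Z ^+ 2 - 1 by nra.
have h := is_derive1_sqrt Z1.
have g : is_derive Z 1 (fun Z : R => Z ^+ 2 - 1) (2 * Z) by solve_is_derive ltac:(ring).
notypeclasses refine (is_derive_conv (@der_comp R Num.sqrt (fun Z => Z ^+ 2 - 1) Z _ _ h g) _).
by have := Spos Z2; rewrite /S => s0; field; lra.
Qed.

(* With Z = cosh r, S = sinh r and W = S^{1/2} p0, the Legendre equation is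
   W_rr + (M^2 + 1 / (4 S^2)) W = 0, W_r = G / S^{1/2}, and
   E = W_r^2 + M^2 W^2 + W^2 / (4 S^2) decreases because 1 / S^2 does. *)
Let G (Z : R) := S Z ^+ 2 * p1 Z + 2^-1 * Z * p0 Z.

Let E (Z : R) := G Z ^+ 2 * (S Z)^-1 + M ^+ 2 * S Z * p0 Z ^+ 2 + 4^-1 * p0 Z ^+ 2 * (S Z)^-1.

Let E_le (Z : R) : 2 <= Z -> E Z <= E 2.
Proof.
move=> Z2.
(* In E_r only the derivative of the coefficient 1 / (4 S^2) survives, namely -Z / (2 S^3),
   multiplied by W^2 = S p0^2; dZ = S dr turns the product into this function. *)
apply: (@derivative_le0_le E (fun Z => - (Z * p0 Z ^+ 2 / (2 * S Z ^+ 3)))) => // x.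
  case/andP=> x2 _; have s0 := Spos x2; have ss := SS x2; have ds := dS x2.
  have [d0 d1 ode] := legp (ltac:(lra) : 2^-1 < x).
  have p2E : p2 x = - (2 * x * p1 x + (M ^+ 2 + 4^-1) * p0 x) / S x ^+ 2.
    have sn : S x ^+ 2 != 0 by rewrite expf_neq0 // gt_eqF.
    by apply: (mulIf sn); rewrite divfK // {1}ss; lra.
  have sn : S x != 0 by rewrite gt_eqF.
  rewrite /E /G; solve_is_derive ltac:(idtac).
  (* The relation S^2 = x^2 - 1 is not visible to [field]; the correction term, a multiple of x^2 -
     1 - S^2, makes the identity hold with S as a free variable. *)
  transitivity (- (x * p0 x ^+ 2 / (2 * S x ^+ 3))
     - (x ^+ 2 - 1 - S x ^+ 2) * (S x ^+ 2 * p1 x + 2^-1 * x * p0 x) * p0 x / (2 * S x ^+ 3)).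
    by rewrite p2E; field.
  by rewrite ss; ring.
case/andP=> x2 _; have s0 := Spos x2; have x0 : 0 <= x by lra.
by rewrite oppr_le0; nonneg.
Qed.

Let W (Z : R) := Num.sqrt (S Z) * p0 Z.

Let dW (Z : R) : 2 <= Z -> is_derive Z 1 W (G Z / (S Z * Num.sqrt (S Z))).
Proof.
move=> Z2; have s0 := Spos Z2; have ds := dS Z2.
have h := is_derive1_sqrt s0.
have [d0 _ _] := legp (ltac:(lra) : 2^-1 < Z).
have g := der_comp h ds.
have q0 : 0 < Num.sqrt (S Z) by rewrite sqrtr_gt0.
have qq : Num.sqrt (S Z) ^+ 2 = S Z by rewrite sqr_sqrtr // ltW.
rewrite /W /G; solve_is_derive ltac:(idtac).
have e : Num.sqrt (S Z) * p1 Z = S Z * p1 Z / Num.sqrt (S Z).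
  by rewrite -{2}qq; field; lra.
by rewrite e; field; lra.
Qed.

Let dW_bound (Z : R) : 2 <= Z ->
  `|G Z / (S Z * Num.sqrt (S Z))| <= 2 * Num.sqrt (E 2) / Z.
Proof.
move=> Z2; have s0 := Spos Z2.
have q0 : 0 < Num.sqrt (S Z) by rewrite sqrtr_gt0.
have qq : Num.sqrt (S Z) ^+ 2 = S Z by rewrite sqr_sqrtr // ltW.
have GE : G Z ^+ 2 <= E 2 * S Z.
  rewrite -ler_pdivrMr //; apply: le_trans (E_le Z2); rewrite /E -addrA lerDl.
  by nonneg.
have absG : `|G Z| <= Num.sqrt (E 2) * Num.sqrt (S Z).
  by rewrite -sqrtr_sqr [leRHS]mulrC -sqrtrM ?(ltW s0) // ler_wsqrtr // mulrC.
rewrite normrM normfV (gtr0_norm (mulr_gt0 s0 q0)) ler_pdivrMr ?mulr_gt0 //.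
apply: (le_trans absG).
rewrite (_ : _ * (_ * _) = Num.sqrt (E 2) * Num.sqrt (S Z) * (2 * S Z / Z)); last by field; lra.
rewrite ler_peMr ?mulr_ge0 ?sqrtr_ge0 //.
by rewrite ler_pdivlMr; [have := Sge Z2; lra|lra].
Qed.

(** At M = 0 the energy gives no uniform bound on W, only one on W_r. Integrating |W_r| <= sqrt E
    with dr = dZ / S and S >= Z / 2 bounds W at the price of a logarithm. *)
Let W_bound (Z : R) : 2 <= Z -> `|W Z| <= `|W 2| + 2 * Num.sqrt (E 2) * ln Z.
Proof.
move=> Z2; pose k := 2 * Num.sqrt (E 2).
have k0 : 0 <= k by rewrite mulr_ge0 ?sqrtr_ge0.
have l2 : 0 <= ln 2 :> R by apply: ln_ge0; lra.
have dln (x : R) : 2 <= x -> is_derive x 1 (@ln R) x^-1.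
  by move=> x2; apply: is_derive1_ln; lra.
have up : W Z - k * ln Z <= W 2 - k * ln 2.
  apply: (@derivative_le0_le (fun Z => W Z - k * ln Z)
    (fun Z => G Z / (S Z * Num.sqrt (S Z)) - k / Z)) => // x /andP[x2 _].
    by have d1 := dW x2; have d2 := dln x x2; solve_is_derive ltac:(ring).
  by have := dW_bound x2; rewrite ler_norml -/k => /andP[_]; lra.
have dn : - W Z - k * ln Z <= - W 2 - k * ln 2.
  apply: (@derivative_le0_le (fun Z => - W Z - k * ln Z)
    (fun Z => - (G Z / (S Z * Num.sqrt (S Z))) - k / Z)) => // x /andP[x2 _].
    by have d1 := dW x2; have d2 := dln x x2; solve_is_derive ltac:(ring).
  by have := dW_bound x2; rewrite ler_norml -/k => /andP[]; lra.
have kl : 0 <= k * ln 2 by rewrite mulr_ge0.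
rewrite ler_norml -/k; have := ler_norm (W 2); have := ler_norm (- W 2).
by rewrite normrN => ? ?; apply/andP; split; lra.
Qed.

(** E is singular at Z = 1, so the argument is split at Z = 2: compactness below, where sqrt Z <= 2,
    and the bound on W above, where sqrt Z <= 2 sqrt S. The two terms of the constant correspond to
    the two ranges. *)
Lemma legendre_bound : exists2 C : R, 0 <= C & forall Z, 1 <= Z ->
  `|p0 Z| * Num.sqrt Z <= C * (1 + ln Z).
Proof.
have [c _ Hc] : exists2 c : R, c \in `[1, 2]%R & forall Z, Z \in `[1, 2]%R -> `|p0 Z| <= `|p0 c|.
  apply: EVT_max; first by lra.
  by apply: continuous_subspaceT; exact: cont_norm.
pose k := 2 * Num.sqrt (E 2).
have k0 : 0 <= k by rewrite mulr_ge0 ?sqrtr_ge0.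
exists (2 * `|p0 c| + 2 * (`|W 2| + k)) => [|Z Z1].
  by rewrite addr_ge0 ?mulr_ge0 ?addr_ge0.
have l0 : 0 <= ln Z by apply: ln_ge0.
have a0 := normr_ge0 (p0 c); have w0 := normr_ge0 (W 2).
have wk : 0 <= (`|W 2| + k) * (1 + ln Z) by rewrite mulr_ge0 //; lra.
have al : 0 <= `|p0 c| * ln Z by rewrite mulr_ge0.
have q0 := sqrtr_ge0 Z.
have qq : Num.sqrt Z ^+ 2 = Z by rewrite sqr_sqrtr //; lra.
have [Z2|/ltW Z2] := leP Z 2.
  have hp : `|p0 Z| <= `|p0 c| by apply: Hc; rewrite in_itv /= Z1.
  have q2 : Num.sqrt Z <= 2 by nra.
  have : `|p0 Z| * Num.sqrt Z <= `|p0 c| * 2 by exact: ler_pM.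
  by lra.
have s0 := Spos Z2; have sg := Sge Z2.
have qs0 := sqrtr_ge0 (S Z).
have qsq : Num.sqrt (S Z) ^+ 2 = S Z by rewrite sqr_sqrtr // ltW.
have q2 : Num.sqrt Z <= 2 * Num.sqrt (S Z) by nra.
have hW : `|W Z| = Num.sqrt (S Z) * `|p0 Z| by rewrite /W normrM ger0_norm.
have := W_bound Z2; rewrite -/k hW => hb.
have : `|p0 Z| * Num.sqrt Z <= `|p0 Z| * (2 * Num.sqrt (S Z)) by rewrite ler_wpM2l.
have : 0 <= `|W 2| * ln Z by rewrite mulr_ge0.
by nra.
Qed.

End LegendreBound.

(** * Green's formula on a rectangle *)

Section PairContinuity.
Context {R : realType} {T : topologicalType}.

Lemma cont_pair (f g : T -> R) : continuous f -> continuous g ->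
  continuous (fun x => (f x, g x)).
Proof. by move=> cf cg x; exact: (cvg_pair (cf x) (cg x)). Qed.

Lemma cont_comp2 (G : R * R -> R) (f g : T -> R) : continuous G ->
  continuous f -> continuous g -> continuous (fun x => G (f x, g x)).
Proof.
by move=> cG cf cg x; apply: continuous_comp; [exact: cont_pair|exact: cG].
Qed.

End PairContinuity.

Lemma cont_id {T : topologicalType} : continuous (fun x : T => x).
Proof. by move=> x; exact: cvg_id. Qed.

Section Rectangle.
Context {R : realType}.
Local Notation mu := (@lebesgue_measure R).
Local Notation mR := (measurableTypeR R).

(** The product sigma-algebra is generated by measurable rectangles and not by the topology; a
    countable cover by boxes with rational corners links the two, so that Fubini applies to
    continuous functions of two variables. *)
Lemma open_measurable_prod (U : set (R * R)) : open U ->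
  measurable (U : set (mR * mR)).
Proof.
move=> oU.
pose box (q : (rat * rat) * (rat * rat)) : set (mR * mR) :=
  [set` `]ratr q.1.1 : R, ratr q.1.2[] `*` [set` `]ratr q.2.1 : R, ratr q.2.2[].
pose F q := if pselect (box q `<=` U) then box q else set0.
have -> : U = \bigcup_q F q.
  apply/seteqP; split=> [[x y] Uxy|z [q _]]; last first.
    by rewrite /F; case: pselect => // h; exact: h.
  have : nbhs (x, y) U by exact: open_nbhs_nbhs.
  case=> -[A B] /= [/nbhs_ballP[e e0 eA] /nbhs_ballP[d d0 dB]] AB.
  have [a1] := @rat_in_itvoo R (x - e) x (ltac:(by move: e0 => /=; lra)).
  have [a2] := @rat_in_itvoo R x (x + e) (ltac:(by move: e0 => /=; lra)).
  have [b1] := @rat_in_itvoo R (y - d) y (ltac:(by move: d0 => /=; lra)).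
  have [b2] := @rat_in_itvoo R y (y + d) (ltac:(by move: d0 => /=; lra)).
  rewrite !in_itv /= => /andP[h1 h2] /andP[h3 h4] /andP[h5 h6] /andP[h7 h8].
  exists ((a1, a2), (b1, b2)) => //; rewrite /F.
  case: pselect => [sub|]; first by split; rewrite /= in_itv /=; apply/andP.
  case=> -[x' y'] [/=]; rewrite !in_itv /= => /andP[i1 i2] /andP[i3 i4].
  apply: AB; split => /=; [apply: eA|apply: dB];
    by rewrite /ball /= ltr_norml; apply/andP; split; lra.
apply: countable_bigcupT_measurable; first exact: countableP.
move=> q; rewrite /F; case: pselect => /= sub; last exact: measurable0.
exact: measurableX.
Qed.

Lemma continuous_measurable_prod (f : R * R -> R) : continuous f ->
  measurable_fun setT (f : mR * mR -> mR).
Proof.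
move=> cf; apply: (measurability _ (RGenOInfty.measurableE R)).
move=> /= _ [_ [a ->]] <-; rewrite setTI; apply: open_measurable_prod.
by apply: open_comp => // z _; exact: cf.
Qed.

Lemma ftc_continuous (F f : R -> R) (a b : R) : a < b ->
  continuous f -> continuous F ->
  (forall x, a < x < b -> is_derive x 1 F (f x)) ->
  (\int[mu]_(x in `[a, b]) (f x)%:E = (F b - F a)%:E)%E.
Proof.
move=> ab cf cF dF; rewrite EFinB; apply: continuous_FTC2 => //.
- exact: continuous_subspaceT.
- split=> [x||].
  + by rewrite in_itv /= => /dF [].
  + by apply: cvg_at_right_filter; exact: cF.
  + by apply: cvg_at_left_filter; exact: cF.
- by move=> x; rewrite in_itv /= derive1E => /dF [].
Qed.

Variables (a b c d : R).
Hypotheses (ab : a < b) (cd : c < d).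

Definition rect : set (mR * mR) := `[a, b]%classic `*` `[c, d]%classic.

Lemma measurable_rect : measurable rect.
Proof. exact: measurableX. Qed.

Lemma rect_integrable (G : R * R -> R) : continuous G ->
  (mu \x mu)%E.-integrable rect (EFin \o G).
Proof.
move=> cG; apply: measurable_bounded_integrable.
- exact: measurable_rect.
- rewrite [X in (X < _)%E](_ : _ = (mu `[a, b] * mu `[c, d])%E); last exact: product_measure1E.
  by rewrite !lebesgue_measure_itv /= !lte_fin ab cd -!EFinB -EFinM ltry.
- by apply: measurable_funTS; exact: continuous_measurable_prod.
- have cpt : compact (`[a, b] `*` `[c, d] : set (R * R)).
    by apply: compact_setX; exact: segment_compact.
  have /compact_bounded[N [_ mrt]] := continuous_compact (continuous_subspaceT cG) cpt.
  exists N; split; rewrite ?num_real // => x Nx z Dz.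
  by apply: mrt => //; exists z.
Qed.

Lemma rect_int12 (G : R * R -> R) : continuous G ->
  (\int[mu \x mu]_(z in rect) (G z)%:E =
   \int[mu]_(t in `[a, b]) \int[mu]_(y in `[c, d]) (G (t, y))%:E)%E.
Proof.
move=> cG; have iG := rect_integrable cG.
rewrite integral_mkcond -integral12_prod_meas1; last first.
  by apply/(integrable_mkcond _ measurable_rect).
rewrite [RHS]integral_mkcond; apply: eq_integral => t _.
rewrite /fubini_F patchE; case: ifPn => [tab|tab].
  rewrite [RHS]integral_mkcond; apply: eq_integral => y _.
  rewrite !patchE; congr (if _ then _ else _).
  by apply/idP/idP; rewrite !inE /rect /=; [case|move: tab; rewrite inE; split].
apply: integral0_eq => y _; rewrite patchE ifF //.
by apply/negbTE; apply: contra tab; rewrite !inE => -[].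
Qed.

Lemma rect_int21 (G : R * R -> R) : continuous G ->
  (\int[mu \x mu]_(z in rect) (G z)%:E =
   \int[mu]_(y in `[c, d]) \int[mu]_(t in `[a, b]) (G (t, y))%:E)%E.
Proof.
move=> cG; have iG := rect_integrable cG.
rewrite integral_mkcond -integral21_prod_meas1; last first.
  by apply/(integrable_mkcond _ measurable_rect).
rewrite [RHS]integral_mkcond; apply: eq_integral => y _.
rewrite /fubini_G patchE; case: ifPn => [ycd|ycd].
  rewrite [RHS]integral_mkcond; apply: eq_integral => t _.
  rewrite !patchE; congr (if _ then _ else _).
  by apply/idP/idP; rewrite !inE /rect /=; [case|move: ycd; rewrite inE; split].
apply: integral0_eq => t _; rewrite patchE ifF //.
by apply/negbTE; apply: contra ycd; rewrite !inE => -[].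
Qed.

(* Green's formula for div (A, B) = g, with the t-boundary values of A zero and
   the flux of B through the sides y = c and y = d written as - C'. *)
Lemma green_rect (A At B g : R * R -> R) (C : R -> R) :
  continuous A -> continuous At -> continuous B -> continuous g -> continuous C ->
  (forall t y, a < t < b -> c <= y <= d -> is_derive t 1 (fun s => A (s, y)) (At (t, y))) ->
  (forall t y, a < t < b -> c < y < d ->
     is_derive y 1 (fun z => B (t, z)) (At (t, y) - g (t, y))) ->
  (forall y, A (a, y) = 0) -> (forall y, A (b, y) = 0) ->
  (forall t, a < t < b -> is_derive t 1 C (B (t, c) - B (t, d))) ->
  (`| (C b - C a)%:E | <=
   \int[mu]_(t in `[a, b]) \int[mu]_(y in `[c, d]) (`|g (t, y)|)%:E)%E.
Proof.
move=> cA cAt cB cg cC dA dB Aa Ab dC.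
have pair1 (G : R * R -> R) y : continuous G -> continuous (fun t => G (t, y)).
  by move=> cG; apply: cont_comp2 => //; [exact: cont_id|exact: cont_cst].
have pair2 (G : R * R -> R) t : continuous G -> continuous (fun y => G (t, y)).
  by move=> cG; apply: cont_comp2 => //; [exact: cont_cst|exact: cont_id].
(* Integrating in t first leaves only the boundary values of [A], which vanish at both ends. *)
have PA : (\int[mu \x mu]_(z in rect) (At z)%:E = 0)%E.
  rewrite rect_int21 // integral0_eq // => y /=; rewrite in_itv /= => ycd.
  have := @ftc_continuous (fun t => A (t, y)) (fun t => At (t, y)) _ _ ab
    (pair1 _ y cAt) (pair1 _ y cA) (fun t tab => dA t y tab ycd).
  by rewrite Aa Ab subrr.
have cAg : continuous (fun z => At z - g z) by apply: contD => //; exact: contN.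
have ftcB t : a < t < b ->
    (\int[mu]_(y in `[c, d]) (At (t, y) - g (t, y))%:E = (B (t, d) - B (t, c))%:E)%E.
  move=> tab; exact: (@ftc_continuous (fun y => B (t, y)) _ _ _ cd
    (pair2 _ t cAg) (pair2 _ t cB) (fun y => dB t y tab)).
have cBB : continuous (fun t => B (t, d) - B (t, c)).
  by apply: contD; [exact: pair1|apply: contN; exact: pair1].
have mBB : measurable_fun `]a, b[%classic (EFin \o (fun t => B (t, d) - B (t, c))).
  by apply/measurable_EFinP/measurable_funTS; exact: continuous_measurable_fun.
have PAg : (\int[mu \x mu]_(z in rect) (At z - g z)%:E = - (C b - C a)%:E)%E.
  (* The derivative of [B] in y is assumed only for a < t < b; dropping the two end times changes no
     integral and makes [ftcB] available at every remaining t. *)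
  rewrite rect_int12 // integral_itv_bndoo; last first.
    apply: (@eq_measurable_fun _ _ _ _ _ (fun t => (B (t, d) - B (t, c))%:E)) => // t.
    by rewrite inE /= in_itv /= => /ftcB.
  transitivity (\int[mu]_(t in `]a, b[) (B (t, d) - B (t, c))%:E)%E.
    by apply: eq_integral => t; rewrite inE /= in_itv /= => /ftcB.
  rewrite -(@integral_itv_bndoo _ _ _ _ true false) //.
  have dCN t : a < t < b -> is_derive t 1 (fun s => - C s) (B (t, d) - B (t, c)).
    by move=> tab; notypeclasses refine (is_derive_conv (derN (dC t tab)) _); ring.
  rewrite (@ftc_continuous (fun t => - C t) _ _ _ ab cBB (contN cC) dCN).
  by rewrite -EFinN; congr EFin; ring.
have PB := integralB_EFin measurable_rect (rect_integrable cAt) (rect_integrable cg).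
have Pg : (\int[mu \x mu]_(z in rect) (g z)%:E = (C b - C a)%:E)%E.
  move: PB; rewrite PAg PA sub0e => /(congr1 (fun x => - x)%E).
  by rewrite !oppeK => ->.
rewrite -Pg -(@rect_int12 (fun z => `|g z|)); last exact: cont_norm.
apply: le_trans (le_abse_integral _ measurable_rect _) _.
  by apply: (measurable_int (mu \x mu)%E); exact: rect_integrable.
by [].
Qed.

End Rectangle.

(** * Extension of the solution to the plane *)

Section TimeTruncation.
Context {R : realType}.

(** A chain rule from separate partial derivatives, without joint differentiability. The increment
    is split at (c s, r): the x-part is handled by the mean value theorem, whose intermediate point
    tends to c s, where gx is continuous; the t-part uses only the derivative at the fixed abscissa
    c s. *)
Lemma chain_curve (g gx : R -> R -> R) (c : R -> R) (s c' l : R) :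
  (forall x t : R, is_derive x 1 (g^~ t) (gx x t)) ->
  continuous (fun z : R * R => gx z.1 z.2) ->
  is_derive s 1 c c' -> is_derive s 1 (g (c s)) l ->
  is_derive s 1 (fun r => g (c r) r) (gx (c s) s * c' + l).
Proof.
move=> dg cgx dc dgs.
have mvt r : exists xi, `|xi - c s| <= `|c r - c s| /\
    g (c r) r - g (c s) r = gx xi r * (c r - c s).
  have cont a b : {within `[a, b], continuous (g^~ r)}.
    by apply: continuous_subspaceT => x; exact: is_derive_continuous (dg x r).
  have [le|/ltW le] := leP (c s) (c r).
    have [xi + e] := MVT_segment le (fun x _ => dg x r) (cont _ _).
    rewrite in_itv /= => /andP[h1 h2]; exists xi; split => //.
    by rewrite !ger0_norm; lra.
  have [xi + e] := MVT_segment le (fun x _ => dg x r) (cont _ _).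
  rewrite in_itv /= => /andP[h1 h2]; exists xi; split; last by lra.
  by rewrite !ler0_norm; lra.
have /choice[xi Hxi] := mvt.
have [kc [ekc ckc kcs]] := (is_derive1_caratheodory c s c').1 dc.
have [kg [ekg ckg kgs]] := (is_derive1_caratheodory (g (c s)) s l).1 dgs.
have cc := is_derive_continuous dc.
have xis : xi s = c s.
  by have [] := Hxi s; rewrite subrr normr0 normr_le0 subr_eq0 => /eqP.
have cxi : {for s, continuous xi}.
  rewrite /prop_for /continuous_at xis.
  apply/cvgrPdist_le => e e0; near=> r.
  rewrite distrC; apply: le_trans (Hxi r).1 _; rewrite distrC.
  by near: r; move/cvgrPdist_le : cc; exact.
apply/is_derive1_caratheodory; exists (fun r => gx (xi r) r * kc r + kg r); split.
- move=> r; rewrite mulrDl -ekg -mulrA -ekc -(Hxi r).2; ring.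
- apply: cvgD; last exact: ckg.
  apply: cvgM; last exact: ckc.
  apply: (@continuous_comp _ _ _ (fun r => (xi r, r)) (fun z : R * R => gx z.1 z.2)).
    by exact: (cvg_pair cxi cvg_id).
  exact: cgx.
- by rewrite xis kcs kgs.
Unshelve. all: by end_near. Qed.

(* Freezing g at negative times turns continuity on the closed half-plane into
   continuity on the plane. *)
Definition trunc (g : R -> R -> R) x t := g x (Num.max t 0).

Definition jcont (g : R -> R -> R) := continuous (fun z : R * R => g z.1 z.2).

Lemma truncE g x t : 0 <= t -> trunc g x t = g x t.
Proof. by move=> t0; rewrite /trunc max_l. Qed.

Lemma trunc_jcont g : {within half_plane, continuous (fun z : R * R => g z.1 z.2)} ->
  jcont (trunc g).
Proof.
move=> /subspace_continuousP cg z.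
pose r (w : R * R) := (w.1, Num.max w.2 0).
have hr w : half_plane (r w) by rewrite /half_plane /= le_max lexx orbT.
have cr : continuous r.
  apply: cont_pair; first by move=> w; exact: cvg_fst.
  by apply: cont_max; [move=> w; exact: cvg_snd|exact: cont_cst].
apply: (@cvg_comp _ _ _ r (fun w => g w.1 w.2) (nbhs z) (within half_plane (nbhs (r z)))).
  move=> P hP.
  have h2 : nbhs z (r @^-1` [set w | half_plane w -> P w]) := cr z _ hP.
  by change (nbhs z (r @^-1` P)); apply: filterS h2 => w; apply.
exact: cg.
Qed.

Lemma trunc_is_derive g x t l : 0 < t -> is_dt g x t l -> is_derive t 1 (trunc g x) l.
Proof.
move=> t0 dg; apply/is_derive1_caratheodory.
exists (fun s => if s == t then l else (trunc g x s - trunc g x t) / (s - t)); split.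
- move=> s; case: eqP => [->|/eqP]; first by rewrite !subrr mulr0.
  by rewrite -subr_eq0 => /divfK->.
- apply/continuous_withinNx; rewrite eqxx.
  move=> P /dg; rewrite /= /within /= => hP.
  have ev : \forall s \near t, 0 < s by exact: (@open_gt _ _ t).
  apply: filterS2 ev hP => s s0 h st.
  by rewrite /= (negbTE st) !truncE ?ltW //; exact: h (ltW s0).
- by rewrite eqxx.
Qed.

Lemma dt_is_derive (g : R -> R -> R) (x t l : R) : 0 < t -> is_dt g x t l -> is_derive t 1 (g x) l.
Proof.
move=> t0 /(trunc_is_derive t0); apply: is_derive_near.
have : \forall s \near t, 0 < s by exact: (@open_gt _ _ t).
by apply: filterS => s s0; rewrite truncE ?ltW.
Qed.

(** What Green's formula uses of the extended solution. Continuity and x-derivatives hold on the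
    whole plane; t-derivatives and the equation are kept to t > 0, since freezing at t = 0 may
    create a corner. *)
Record cauchy_data (M : R) (U Ux Ut Uxx Utx Utt F : R -> R -> R) : Prop := CauchyData {
  cd_U : jcont U; cd_Ux : jcont Ux; cd_Ut : jcont Ut; cd_Uxx : jcont Uxx;
  cd_Utx : jcont Utx; cd_Utt : jcont Utt; cd_F : jcont F;
  cd_dx : forall x t : R, is_derive x 1 (U^~ t) (Ux x t);
  cd_dxx : forall x t : R, is_derive x 1 (Ux^~ t) (Uxx x t);
  cd_dtx : forall x t : R, is_derive x 1 (Ut^~ t) (Utx x t);
  cd_dt : forall x t : R, 0 < t -> is_derive t 1 (U x) (Ut x t);
  cd_dtt : forall x t : R, 0 < t -> is_derive t 1 (Ut x) (Utt x t);
  cd_eq : forall x t : R, 0 < t ->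
    Utt x t - expR (- (2 * t)) * Uxx x t + M ^+ 2 * U x t = F x t;
  cd_U0 : forall x, U x 0 = 0;
  cd_Ut0 : forall x, Ut x 0 = 0 }.

Lemma trunc_dx g gx : (forall x t : R, 0 <= t -> is_derive x 1 (g^~ t) (gx x t)) ->
  forall x t : R, is_derive x 1 ((trunc g)^~ t) (trunc gx x t).
Proof. by move=> dg x t; apply: dg; rewrite le_max lexx orbT. Qed.

(** Identifies the time derivative provided by the regularity of u with the prescribed initial
    velocity 0. The one-sided punctured filter at 0 is proper because it always meets the point e /
    2. *)
Lemma is_dt_unique g (x l l' : R) : is_dt g x 0 l -> is_dt g x 0 l' -> l = l'.
Proof.
move=> h h'; apply: (@cvg_unique _ (@Rhausdorff R) _ _ _ _ h h').
apply: Build_ProperFilter; rewrite /within /= => /nbhs_ballP[e /= e0].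
move=> /(_ (e / 2)); apply => /=.
- by rewrite /ball /= sub0r normrN gtr0_norm; lra.
- by rewrite gt_eqF //; lra.
- by lra.
Qed.

Lemma cauchy_data_exists M f u : Ck_half_plane 2 f -> is_cauchy_solution M f u ->
  exists Ux Ut Uxx Utx Utt, cauchy_data M (trunc u) Ux Ut Uxx Utx Utt (trunc f).
Proof.
move=> [cf _] [[cu [ux [ut [dux dut [cux [uxx [uxt [duxx _ [cuxx _] _]]]]
  [cut [utx [utt [dutx dutt [cutx _] [cutt _]]]]]]]]] pde u0 ut0].
exists (trunc ux), (trunc ut), (trunc uxx), (trunc utx), (trunc utt).
have dt (x t : R) : 0 < t -> is_derive t 1 (trunc u x) (trunc ut x t).
  by move=> t0; rewrite truncE ?ltW //; apply: trunc_is_derive => //; apply: dut; exact: ltW.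
have dtt (x t : R) : 0 < t -> is_derive t 1 (trunc ut x) (trunc utt x t).
  by move=> t0; rewrite truncE ?ltW //; apply: trunc_is_derive => //; apply: dutt; exact: ltW.
split => //; try exact: trunc_jcont; try exact: trunc_dx.
- move=> x t t0; have t0' := ltW t0; rewrite !truncE // -pde //; congr (_ - _ * _ + _).
  + rewrite derive1nS derive1E derive1n1.
    have [_ e] := dtt x t t0; rewrite -(truncE utt x t0') -e; apply: near_eq_derive.
    have : \forall s \near t, 0 < s by exact: (@open_gt _ _ t).
    apply: filterS => s s0; have [_ e'] := dt_is_derive s0 (dut x s (ltW s0)).
    by rewrite derive1E e' truncE ?ltW.
  + rewrite derive1nS derive1n1 derive1E (_ : (u^~ t)^`()%classic = ux^~ t).
      by have [_ ->] := duxx x t t0'.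
    by apply/funext => y; rewrite derive1E; have [_ ->] := dux y t t0'.
- by move=> x; rewrite truncE.
- by move=> x; rewrite truncE //; apply: is_dt_unique (ut0 x); exact: dut.
Qed.

End TimeTruncation.

(** * The Riemann function *)

Section Riemann.
Context {R : realType} {T : topologicalType}.

Lemma jcont_comp (G : R -> R -> R) (f g : T -> R) : jcont G ->
  continuous f -> continuous g -> continuous (fun x => G (f x) (g x)).
Proof. by move=> cG cf cg; apply: (@cont_comp2 _ _ (fun z => G z.1 z.2)). Qed.

End Riemann.

Lemma cont_fst {R : realType} : continuous (fun z : R * R => z.1).
Proof. by move=> z; exact: cvg_fst. Qed.

Lemma cont_snd {R : realType} : continuous (fun z : R * R => z.2).
Proof. by move=> z; exact: cvg_snd. Qed.

Section RiemannMethod.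
Context {R : realType}.
Local Notation mu := (@lebesgue_measure R).
Variables (M : R) (p0 p1 p2 : R -> R).
Hypotheses (cp0 : continuous p0) (cp1 : continuous p1) (cp2 : continuous p2).
Hypothesis p01 : p0 1 = 1.
Hypothesis legp : forall Z : R, 2^-1 < Z ->
  [/\ is_derive Z 1 p0 (p1 Z), is_derive Z 1 p1 (p2 Z) &
      (Z ^+ 2 - 1) * p2 Z + 2 * Z * p1 Z + (M ^+ 2 + 4^-1) * p0 Z = 0].

Definition cone_radius (t0 t : R) := expR (- t) - expR (- t0).

(* The argument of the Legendre function in the Riemann function with pole
   (0, t0), at the point (x, t). *)
Definition cone_arg (t0 x t : R) :=
  2^-1 * (expR t0 * expR (- t) + expR t * expR (- t0) - x ^+ 2 * expR t * expR t0).

(** In this form Z >= 1 on the cone is evident, with equality on the sides y = 1 and y = -1. *)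
Lemma cone_argE (t0 t y : R) : cone_arg t0 (cone_radius t0 t * y) t =
  1 + 2^-1 * cone_radius t0 t ^+ 2 * expR t * expR t0 * (1 - y ^+ 2).
Proof.
rewrite /cone_arg /cone_radius !expRN.
have h : expR t != 0 by rewrite gt_eqF ?expR_gt0.
have h0 : expR t0 != 0 by rewrite gt_eqF ?expR_gt0.
by field; apply/andP.
Qed.

Definition riemann_fun (t0 x t : R) := expR (2^-1 * (t + t0)) * p0 (cone_arg t0 x t).

Variables (U Ux Ut Uxx Utx Utt F : R -> R -> R).
Hypothesis cdata : cauchy_data M U Ux Ut Uxx Utx Utt F.
Variables (t0 x0 : R).
Hypothesis t0pos : 0 < t0.

Let phi := cone_radius t0.
Let X (t y : R) := phi t * y.
Let Y (t y : R) := x0 + X t y.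
Let Z (t y : R) := cone_arg t0 (X t y) t.
(** From here to [Kxx], partial derivatives are taken in the original variables (t, x) and only then
    evaluated at x = X t y. The formulas use Z_tt = Z, Z_tx = Z_x and Z_xx = - e^{t + t0}. *)
Let Zt (t y : R) := 2^-1 * (- (expR t0 * expR (- t)) + expR t * expR (- t0) - X t y ^+ 2 * expR t * expR t0).
Let Zx (t y : R) := - (X t y * expR t * expR t0).
Let k (t : R) := expR (2^-1 * (t + t0)).
Let K (t y : R) := k t * p0 (Z t y).
Let Kt (t y : R) := k t * (2^-1 * p0 (Z t y) + p1 (Z t y) * Zt t y).
Let Kx (t y : R) := k t * (p1 (Z t y) * Zx t y).
Let Ktt (t y : R) := k t * (4^-1 * p0 (Z t y) + p1 (Z t y) * Zt t y + p2 (Z t y) * Zt t y ^+ 2 + p1 (Z t y) * Z t y).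
Let Ktx (t y : R) := k t * (2^-1 * p1 (Z t y) * Zx t y + p2 (Z t y) * Zt t y * Zx t y + p1 (Z t y) * Zx t y).
Let Kxx (t y : R) := k t * (p2 (Z t y) * Zx t y ^+ 2 - p1 (Z t y) * expR t * expR t0).

Let r0 (t : R) : expR t != 0.
Proof. by rewrite gt_eqF ?expR_gt0. Qed.

Let Z_ge (t y : R) : Z t y = 1 + 2^-1 * phi t ^+ 2 * expR t * expR t0 * (1 - y ^+ 2).
Proof. exact: cone_argE. Qed.

Let Z_gt (t y : R) : - 1 <= y <= 1 -> 2^-1 < Z t y.
Proof.
move=> /andP[y1 y2]; rewrite Z_ge.
have yy : 0 <= 1 - y ^+ 2 by nra.
have : 0 <= 2^-1 * phi t ^+ 2 * expR t * expR t0 * (1 - y ^+ 2) by nonneg.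
by lra.
Qed.

Let dphi (t : R) : is_derive t 1 phi (- expR (- t)).
Proof. by rewrite /phi /cone_radius; solve_is_derive ltac:(ring). Qed.

(* With the sections of the cone rescaled to y in [-1, 1], (A, B) is the Green
   vector field of the equation for the pair (K, U), and g is its divergence. *)
Let A (z : R * R) := phi z.1 * (K z.1 z.2 * Ut (Y z.1 z.2) z.1 - Kt z.1 z.2 * U (Y z.1 z.2) z.1).
Let h (z : R * R) := K z.1 z.2 * Ut (Y z.1 z.2) z.1 - Kt z.1 z.2 * U (Y z.1 z.2) z.1.
Let B (z : R * R) := - expR (- z.1) * z.2 * h z +
  expR (- z.1) ^+ 2 * (K z.1 z.2 * Ux (Y z.1 z.2) z.1 - Kx z.1 z.2 * U (Y z.1 z.2) z.1).
Let g (z : R * R) := phi z.1 * K z.1 z.2 * F (Y z.1 z.2) z.1.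
Let At (z : R * R) :=
  let t := z.1 in let y := z.2 in let v := - expR (- t) * y in
  - expR (- t) * h z +
  phi t * ((Kt t y + Kx t y * v) * Ut (Y t y) t
    + K t y * (Utx (Y t y) t * v + Utt (Y t y) t)
    - (Ktt t y + Ktx t y * v) * U (Y t y) t
    - Kt t y * (Ux (Y t y) t * v + Ut (Y t y) t)).
(** On the characteristic sides K equals k because P(1) = 1, and the conormal direction is
    tangential. The flux there is thus an exact derivative of the boundary values of U weighted by w
    = k e^{-t}. *)
Let w (t : R) := expR (2^-1 * (t0 - t)).
Let C (t : R) := w t * (U (Y t 1) t + U (Y t (- 1)) t).

Let dZ (t y : R) : is_derive t 1 (fun s => Z s y) (Zt t y + Zx t y * (- expR (- t) * y)).
Proof.
have d := dphi t; rewrite /Z /cone_arg /X; solve_is_derive ltac:(idtac).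
by rewrite /Zt /Zx /X; field.
Qed.

Let dZt (t y : R) : is_derive t 1 (fun s => Zt s y) (Z t y + Zx t y * (- expR (- t) * y)).
Proof.
have d := dphi t; rewrite /Zt /X; solve_is_derive ltac:(idtac).
by rewrite /Z /cone_arg /Zx /X; field.
Qed.

Let dYt (t y : R) : is_derive t 1 (fun s => Y s y) (- expR (- t) * y).
Proof. by have d := dphi t; rewrite /Y /X; solve_is_derive ltac:(ring). Qed.

Let dYy (t y : R) : is_derive y 1 (fun z => Y t z) (phi t).
Proof. by rewrite /Y /X; solve_is_derive ltac:(ring). Qed.

Let dk (t : R) : is_derive t 1 k (2^-1 * k t).
Proof. by rewrite /k; solve_is_derive ltac:(ring). Qed.

Let dA (t y : R) : 0 < t < t0 -> - 1 <= y <= 1 -> is_derive t 1 (fun s => A (s, y)) (At (t, y)).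
Proof.
case: cdata => _ _ _ _ cUtx _ _ cdx cdxx cdtx cdt cdtt _ _ _ /andP[tp _] y1.
have [dp0 dp1 _] := legp (Z_gt t y1).
have d1 := dphi t; have d2 := dk t; have d3 := dZt t y.
have d4 := @der_comp R p0 (fun s => Z s y) t _ _ dp0 (dZ t y).
have d5 := @der_comp R p1 (fun s => Z s y) t _ _ dp1 (dZ t y).
have d6 := @chain_curve R U Ux (fun s => Y s y) t _ _ cdx (cd_Ux cdata) (dYt t y) (cdt (Y t y) t tp).
have d7 := @chain_curve R Ut Utx (fun s => Y s y) t _ _ cdtx (cd_Utx cdata) (dYt t y) (cdtt (Y t y) t tp).
rewrite /A /K /Kt /=; solve_is_derive ltac:(idtac).
by rewrite /At /h /K /Kt /Ktt /Kx /Ktx /=; field.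
Qed.

(** By Z_t^2 - e^{-2t} Z_x^2 = Z^2 - 1 and Z_tt + Z_t - e^{-2t} Z_xx = 2 Z, the operator applied to
    k P(Z) is k times the Legendre operator at Z. The factor e^{t/2} in k supplies both the term Z_t
    and the 1/4. *)
Let kernel_eq (t y : R) : - 1 <= y <= 1 ->
  Ktt t y - expR (- (2 * t)) * Kxx t y + M ^+ 2 * K t y = 0.
Proof.
move=> y1; have [_ _ ode] := legp (Z_gt t y1).
have -> : expR (- (2 * t)) = expR (- t) ^+ 2 by rewrite -expRM_natl; congr expR; ring.
rewrite -[RHS](mulr0 (k t)) -ode /Ktt /Kxx /K.
have -> : Z t y ^+ 2 - 1 = Zt t y ^+ 2 - expR (- t) ^+ 2 * Zx t y ^+ 2.
  rewrite /Z /cone_arg /Zt /Zx !expRN.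
  by have e := r0 t; have e0 := r0 t0; field; apply/andP.
have -> : 2 * Z t y * p1 (Z t y) =
    p1 (Z t y) * (Zt t y + Z t y + expR (- t) ^+ 2 * expR t * expR t0).
  rewrite {1 4}/Z /cone_arg /Zt !expRN.
  by have e := r0 t; have e0 := r0 t0; field; apply/andP.
ring.
Qed.

Let dB (t y : R) : 0 < t < t0 -> - 1 < y < 1 ->
  is_derive y 1 (fun z => B (t, z)) (At (t, y) - g (t, y)).
Proof.
case: cdata => _ _ _ _ _ _ _ cdx cdxx cdtx _ _ pde _ _ /andP[tp _] /andP[/ltW y1 /ltW y2].
have yy : - 1 <= y <= 1 by rewrite y1.
have [dp0 dp1 _] := legp (Z_gt t yy).
have dZy : is_derive y 1 (fun z => Z t z) (Zx t y * phi t).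
  by rewrite /Z /cone_arg /X; solve_is_derive ltac:(rewrite /Zx /X; field).
have dZty : is_derive y 1 (fun z => Zt t z) (Zx t y * phi t).
  by rewrite /Zt /X; solve_is_derive ltac:(rewrite /Zx /X; field).
have dZxy : is_derive y 1 (fun z => Zx t z) (- expR t * expR t0 * phi t).
  by rewrite /Zx /X; solve_is_derive ltac:(ring).
have d4 := @der_comp R p0 (fun z => Z t z) y _ _ dp0 dZy.
have d5 := @der_comp R p1 (fun z => Z t z) y _ _ dp1 dZy.
have d6 := @der_comp R (U^~ t) (fun z => Y t z) y _ _ (cdx (Y t y) t) (dYy t y).
have d7 := @der_comp R (Ut^~ t) (fun z => Y t z) y _ _ (cdtx (Y t y) t) (dYy t y).
have d8 := @der_comp R (Ux^~ t) (fun z => Y t z) y _ _ (cdxx (Y t y) t) (dYy t y).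
rewrite /B /h /K /Kt /Kx /=; solve_is_derive ltac:(idtac).
have KE := kernel_eq t yy.
have ee : expR (- (2 * t)) = expR (- t) ^+ 2 by rewrite -expRM_natl; congr expR; ring.
have FE := pde (Y t y) t tp.
(* Green's identity: K and U satisfy equations with the same self-adjoint operator, and the mass
   terms M^2 K U cancel. *)
have kf : K t y * F (Y t y) t = K t y * Utt (Y t y) t - Ktt t y * U (Y t y) t
    - expR (- t) ^+ 2 * (K t y * Uxx (Y t y) t - Kxx t y * U (Y t y) t).
  rewrite -FE ee; rewrite ee in KE.
  have -> : Ktt t y = expR (- t) ^+ 2 * Kxx t y - M ^+ 2 * K t y by lra.
  ring.
have gE : g (t, y) = phi t * (K t y * F (Y t y) t) by rewrite /g /= mulrA.
by rewrite gE kf /At /h /K /Kt /Ktt /Kx /Ktx /Kxx /=; field.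
Qed.

Let dC (t : R) : 0 < t < t0 -> is_derive t 1 C (B (t, - 1) - B (t, 1)).
Proof.
case: cdata => _ _ _ _ _ _ _ cdx _ _ cdt _ _ _ _ /andP[tp _].
have d6 (y : R) := @chain_curve R U Ux (fun s => Y s y) t _ _ cdx (cd_Ux cdata) (dYt t y) (cdt (Y t y) t tp).
have d61 := d6 1; have d62 := d6 (- 1).
have dw : is_derive t 1 w (- 2^-1 * w t) by rewrite /w; solve_is_derive ltac:(ring).
rewrite /C; solve_is_derive ltac:(idtac).
have Z1 : Z t 1 = 1 by rewrite Z_ge; ring.
have ZN1 : Z t (- 1) = 1 by rewrite Z_ge; ring.
have wE : w t = k t * expR (- t) by rewrite /w /k -expRD; congr expR; field.
rewrite /B /h /K /Kt /Kx /= Z1 ZN1 p01 wE.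
(* Z is constant along each side, so its derivative in the direction of the side vanishes. This
   removes the terms in p1(1), and only p0(1) = 1 remains. *)
have zt1 : Zt t 1 = expR (- t) * Zx t 1.
  rewrite /Zt /Zx /X /phi /cone_radius !expRN.
  by have e := r0 t; have e0 := r0 t0; field; apply/andP.
have ztN1 : Zt t (- 1) = - expR (- t) * Zx t (- 1).
  rewrite /Zt /Zx /X /phi /cone_radius !expRN.
  by have e := r0 t; have e0 := r0 t0; field; apply/andP.
by rewrite zt1 ztN1; field.
Qed.

Ltac jcomp H f g := refine (@jcont_comp _ _ _ f g H _ _).
Ltac cont1 := lazymatch goal with
  | |- continuous (fun z => z) => exact: cont_id
  | |- continuous (fun z => fst z) => exact: cont_fst
  | |- continuous (fun z => snd z) => exact: cont_snd
  | |- continuous (fun z => GRing.add (@?f z) (@?g z)) => refine (@contD _ _ f g _ _)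
  | |- continuous (fun z => GRing.mul (@?f z) (@?g z)) => refine (@contM _ _ f g _ _)
  | |- continuous (fun z => GRing.opp (@?f z)) => refine (@contN _ _ f _)
  | |- continuous (fun z => GRing.exp (@?f z) ?n) => refine (@contX _ _ f n _)
  | |- continuous (fun z => expR (@?f z)) => refine (@cont_expR _ _ f _)
  | |- continuous (fun z => p0 (@?f z)) => refine (@cont_comp _ _ p0 f cp0 _)
  | |- continuous (fun z => p1 (@?f z)) => refine (@cont_comp _ _ p1 f cp1 _)
  | |- continuous (fun z => p2 (@?f z)) => refine (@cont_comp _ _ p2 f cp2 _)
  | |- continuous (fun z => U (@?f z) (@?g z)) => jcomp (cd_U cdata) f g
  | |- continuous (fun z => Ux (@?f z) (@?g z)) => jcomp (cd_Ux cdata) f g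
  | |- continuous (fun z => Ut (@?f z) (@?g z)) => jcomp (cd_Ut cdata) f g
  | |- continuous (fun z => Utx (@?f z) (@?g z)) => jcomp (cd_Utx cdata) f g
  | |- continuous (fun z => Utt (@?f z) (@?g z)) => jcomp (cd_Utt cdata) f g
  | |- continuous (fun z => F (@?f z) (@?g z)) => jcomp (cd_F cdata) f g
  | |- _ => exact: cont_cst
  end.
Ltac cont := repeat (cont1; cbv beta).

(** Duhamel's formula, of which only the inequality is kept. The t-flux vanishes at t = 0 by the
    initial data and at t = t0 because the section of the cone shrinks to a point; both sides end at
    that vertex, hence the factor 2. *)
Lemma riemann_bound :
  ((`|2 * U x0 t0|)%:E <= \int[mu]_(t in `[0%R, t0]) \int[mu]_(y in `[(- 1)%R, 1%R])
    (`|cone_radius t0 t * riemann_fun t0 (cone_radius t0 t * y) t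
       * F (x0 + cone_radius t0 t * y) t|)%:E)%E.
Proof.
have cA : continuous A by rewrite /A /K /Kt /Z /Zt /Y /X /k /cone_arg /phi /cone_radius;
    cbv zeta beta; cont.
have cAt : continuous At.
  by rewrite /At /h /K /Kt /Kx /Ktt /Ktx /Z /Zt /Zx /Y /X /k /cone_arg /phi /cone_radius;
    cbv zeta beta; cont.
have cB : continuous B.
  by rewrite /B /h /K /Kt /Kx /Z /Zt /Zx /Y /X /k /cone_arg /phi /cone_radius;
    cbv zeta beta; cont.
have cg : continuous g by rewrite /g /K /Z /Y /X /k /cone_arg /phi /cone_radius;
    cbv zeta beta; cont.
have cC : continuous C by rewrite /C /w /Y /X /phi /cone_radius;
    cbv zeta beta; cont.
have Y0 y : Y t0 y = x0 by rewrite /Y /X /phi /cone_radius subrr mul0r addr0.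
have n11 : - 1 < 1 :> R by lra.
have C0 : C 0 = 0 by rewrite /C !(cd_U0 cdata) addr0 mulr0.
have Ct0 : C t0 = 2 * U x0 t0.
  by rewrite /C !Y0 /w subrr mulr0 expR0 mul1r; ring.
have := green_rect t0pos n11 cA cAt cB cg cC dA dB.
rewrite Ct0 C0 subr0; apply.
- by move=> y; rewrite /A /= (cd_U0 cdata) (cd_Ut0 cdata) !mulr0 subrr mulr0.
- by move=> y; rewrite /A /= /phi /cone_radius subrr mul0r.
- exact: dC.
Qed.

End RiemannMethod.

(** * Young's inequality *)

Section YoungInequality.
Context {R : realType}.
Local Notation mu := (@lebesgue_measure R).
Local Notation mR := (measurableTypeR R).
Local Open Scope ereal_scope.

(** The image of r times Lebesgue measure under y -> s + r y agrees with Lebesgue measure on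
    half-open intervals, hence everywhere by uniqueness. *)
Lemma ge0_integral_affine (s r : R) (g : mR -> \bar R) : (0 < r)%R ->
  measurable_fun setT g -> (forall x, 0 <= g x) ->
  \int[mu]_y (r%:E * g (s + r * y)%R) = \int[mu]_x g x.
Proof.
move=> r0 mg g0.
pose F : mR -> mR := fun y => (s + r * y)%R.
have mF : measurable_fun setT F.
  by apply: measurable_funD => //; apply: measurable_funM.
pose rn : {nonneg R} := NngNum (ltW r0).
have mE A : measurable A -> mu A = pushforward (mscale rn mu) F A.
  move=> mA; apply: (@lebesgue_measure_unique R (pushforward (mscale rn mu) F)) => //.
  move=> _ [[a b]] _ <-.
  transitivity (r%:E * mu (F @^-1` `]a, b]%classic)); last by [].
  have -> : F @^-1` `]a, b]%classic = `](a - s) / r, (b - s) / r]%classic%R.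
    apply/seteqP; split=> y /=; rewrite !in_itv /= /F ltr_pdivrMr // ler_pdivlMr //;
      by rewrite (mulrC y) ltrBlDl lerBrDl.
  rewrite !lebesgue_measure_itv /= !lte_fin ltr_pM2r ?invr_gt0 // ltrD2r.
  case: ifPn => _; last by rewrite mule0.
  by rewrite -!EFinB -EFinM; congr EFin; field; rewrite gt_eqF.
rewrite [RHS](eq_measure_integral (pushforward (mscale rn mu) F)) => [|A mA _]; last exact: mE.
rewrite ge0_integral_pushforward //= preimage_setT ge0_integral_mscale //.
  by rewrite ge0_integralZl_EFin //; [exact: measurableT_comp|exact: ltW].
exact: measurableT_comp.
Qed.

Lemma tonelli_set12 (D1 D2 : set mR) (f : mR * mR -> \bar R) :
  measurable D1 -> measurable D2 -> measurable_fun setT f -> (forall z, 0 <= f z) ->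
  \int[mu \x mu]_(z in D1 `*` D2) f z = \int[mu]_(x in D1) \int[mu]_(y in D2) f (x, y).
Proof.
move=> m1 m2 mf f0; have mD := measurableX m1 m2.
rewrite integral_mkcond fubini_tonelli1; last 2 first.
- by apply/(measurable_restrictT _ mD); exact: measurable_funTS.
- by move=> z; rewrite erestrict_ge0.
rewrite [RHS]integral_mkcond; apply: eq_integral => x _.
rewrite /fubini_F patchE; case: ifPn => [xD|xD].
  rewrite [RHS]integral_mkcond; apply: eq_integral => y _; rewrite !patchE.
  congr (if _ then _ else _).
  by apply/idP/idP; rewrite !inE /=; [case|move: xD; rewrite inE; split].
apply: integral0_eq => y _; rewrite patchE ifF //.
by apply/negbTE; apply: contra xD; rewrite !inE => -[].
Qed.

Lemma tonelli_set21 (D1 D2 : set mR) (f : mR * mR -> \bar R) :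
  measurable D1 -> measurable D2 -> measurable_fun setT f -> (forall z, 0 <= f z) ->
  \int[mu \x mu]_(z in D1 `*` D2) f z = \int[mu]_(y in D2) \int[mu]_(x in D1) f (x, y).
Proof.
move=> m1 m2 mf f0; have mD := measurableX m1 m2.
rewrite integral_mkcond fubini_tonelli2; last 2 first.
- by apply/(measurable_restrictT _ mD); exact: measurable_funTS.
- by move=> z; rewrite erestrict_ge0.
rewrite [RHS]integral_mkcond; apply: eq_integral => y _.
rewrite /fubini_G patchE; case: ifPn => [yD|yD].
  rewrite [RHS]integral_mkcond; apply: eq_integral => x _; rewrite !patchE.
  congr (if _ then _ else _).
  by apply/idP/idP; rewrite !inE /=; [case|move: yD; rewrite inE; split].
apply: integral0_eq => x _; rewrite patchE ifF //.
by apply/negbTE; apply: contra yD; rewrite !inE => -[].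
Qed.

Lemma measurable_int12 d (X : measurableType d) (D2 : set mR) (f : X * mR -> \bar R) :
  measurable D2 -> measurable_fun setT f -> (forall z, 0 <= f z) ->
  measurable_fun setT (fun x => \int[mu]_(y in D2) f (x, y)).
Proof.
move=> m2 mf f0; have mD := measurableX (@measurableT _ X) m2.
have mr : measurable_fun setT (f \_ (setT `*` D2)).
  by apply/(measurable_restrictT _ mD); exact: measurable_funTS.
have := @measurable_fun_fubini_tonelli_F _ _ X mR R mu _ mr
  (fun z => erestrict_ge0 (fun x _ => f0 x) z).
apply: eq_measurable_fun => x _.
rewrite /fubini_F [RHS]integral_mkcond; apply: eq_integral => y _; rewrite !patchE.
congr (if _ then _ else _); apply/idP/idP; rewrite !inE /=; first by case.
by split.
Qed.

Lemma measurable_int21 (D1 : set mR) (f : mR * mR -> \bar R) :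
  measurable D1 -> measurable_fun setT f -> (forall z, 0 <= f z) ->
  measurable_fun setT (fun y => \int[mu]_(x in D1) f (x, y)).
Proof.
move=> m1 mf f0; apply: (@measurable_int12 _ mR D1 (fun z => f (z.2, z.1))) => //.
apply: (measurableT_comp mf (g := fun z : mR * mR => (z.2, z.1))).
by apply: measurable_fun_pair; [exact: measurable_snd|exact: measurable_fst].
Qed.

(** Weighted AM-GM in logarithmic variables: each exponential lies above its tangent at the weighted
    mean [s], and the first-order terms add up to zero. *)
Lemma expR_weighted_mean (a b c x y z : R) :
  (0 <= a -> 0 <= b -> 0 <= c -> a + b + c = 1 ->
   expR (a * x + b * y + c * z) <= a * expR x + b * expR y + c * expR z)%R.
Proof.
move=> a0 b0 c0 abc; set s := (a * x + b * y + c * z)%R.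
have tangent v : (expR s * (1 + (v - s)) <= expR v)%R.
  have -> : expR v = (expR s * expR (v - s))%R by rewrite -expRD; congr expR; ring.
  by rewrite ler_wpM2l ?expR_ge0 // expR_ge1Dx.
have ha := ler_wpM2l a0 (tangent x).
have hb := ler_wpM2l b0 (tangent y).
have hc := ler_wpM2l c0 (tangent z).
apply: le_trans (lerD (lerD ha hb) hc).
rewrite -[X in (X <= _)%R]mulr1 -{1}abc.
have -> : (a * (expR s * (1 + (x - s))) + b * (expR s * (1 + (y - s))) +
  c * (expR s * (1 + (z - s))) =
  expR s * ((a + b + c) * (1 - s) + (a * x + b * y + c * z)))%R by ring.
by rewrite -/s abc mul1r subrK.
Qed.

(* With k^rho = m, 1/q = 1/p - th and 1/rho = 1 - th, this is the pointwise form of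
   k f h = (f^p k^rho)^{1/q} (f^p h^{q'})^{th} (k^rho h^{q'})^{1 - 1/p}, h = u^{q-1}. *)
Lemma young_pointwise (p q th m f u Nf Nm A : R) :
  (1 < p -> 1 < q -> 0 <= th -> q^-1 = p^-1 - th ->
   0 < m -> 0 <= f -> 0 <= u -> 0 < Nf -> 0 < Nm -> 0 < A ->
   m `^ (1 - th) * f * u `^ (q - 1) <=
   Nf `^ p^-1 * Nm `^ (1 - th) * A `^ (1 - q^-1) *
     (q^-1 / (Nf * Nm) * (f `^ p * m) + th / (Nf * A) * (f `^ p * u `^ q)
      + (1 - p^-1) / (Nm * A) * (m * u `^ q)))%R.
Proof.
move=> p1 q1 th0 hq m0 f0 u0 Nf0 Nm0 A0.
have q0 : (0 < q^-1)%R by rewrite invr_gt0; lra.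
have p0 : (0 <= 1 - p^-1)%R by rewrite subr_ge0 invf_le1; lra.
have rhs0 : (0 <= Nf `^ p^-1 * Nm `^ (1 - th) * A `^ (1 - q^-1) *
     (q^-1 / (Nf * Nm) * (f `^ p * m) + th / (Nf * A) * (f `^ p * u `^ q)
      + (1 - p^-1) / (Nm * A) * (m * u `^ q)))%R by nonneg.
(* Logarithms are taken below, so zeros of f and u are set aside; q > 1 rules out the default value
   0^0 = 1. *)
move: f0; rewrite le_eqVlt => /predU1P[f0|f0].
  by rewrite -{1}f0 mulr0 mul0r.
move: u0; rewrite le_eqVlt => /predU1P[u0|u0].
  by rewrite -{1}u0 powR0 ?mulr0 // subr_eq0 gt_eqF.
have pE (x r : R) : (0 < x -> x `^ r = expR (r * ln x))%R by move=> x0; rewrite /powR gt_eqF.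
have xE (x : R) : (0 < x -> x = expR (ln x))%R by move=> x0; rewrite lnK.
rewrite !pE //.
move: (ln m) (ln f) (ln u) (ln Nf) (ln Nm) (ln A) (xE m m0) (xE f f0) (xE u u0) (xE Nf Nf0) (xE Nm Nm0) (xE A A0).
move=> lm lf lu lNf lNm lA -> -> _ -> -> -> {rhs0}.
rewrite -!expRD -!expRN.
have mean := @expR_weighted_mean q^-1 th (1 - p^-1) (p * lf + lm - lNf - lNm)
  (p * lf + q * lu - lNf - lA) (lm + q * lu - lNm - lA) (ltW q0) th0 p0 (ltac:(lra)).
set e := (p^-1 * lNf + (1 - th) * lNm + (1 - q^-1) * lA)%R.
have := ler_wpM2l (expR_ge0 e) mean.
have pn : (p != 0)%R by lra.
have qn : (q != 0)%R by lra.
rewrite -expRD (_ : (e + _)%R = ((1 - th) * lm + lf + (q - 1) * lu)%R); last first.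
  rewrite /e; have -> : (th = p^-1 - q^-1)%R by lra.
  by field; apply/andP.
move=> h; apply: le_trans h _.
rewrite ler_wpM2l ?expR_ge0 // le_eqVlt; apply/orP; left; apply/eqP.
rewrite -!mulrA -!expRD; congr (_ * expR _ + _ * expR _ + _ * expR _)%R; ring.
Qed.

Section YoungIntegral.
Variables (p q th r Nf Nm A : R) (f u m : mR -> mR) (D : set mR).
Hypotheses (p1 : (1 < p)%R) (q1 : (1 < q)%R) (th0 : (0 <= th)%R).
Hypothesis hq : (q^-1 = p^-1 - th)%R.
Hypotheses (r0 : (0 < r)%R) (Nf0 : (0 < Nf)%R) (Nm0 : (0 < Nm)%R) (A0 : (0 < A)%R).
Hypotheses (mf : measurable_fun setT f) (mu_ : measurable_fun setT u)
  (mm : measurable_fun setT m) (mD : measurable D).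
Hypothesis m_ge0 : forall y, (0 <= m y)%R.
Hypothesis m_gt0 : forall y, (- 1 <= y <= 1)%R -> (0 < m y)%R.
Hypothesis int_f : \int[mu]_x (`|f x| `^ p)%:E <= Nf%:E.
Hypothesis int_m : \int[mu]_(y in `[(- 1)%R, 1%R]) (r * m y)%:E <= Nm%:E.
Hypothesis int_u : \int[mu]_(x in D) (`|u x| `^ q)%:E <= A%:E.

Let I : set mR := `[(- 1)%R, 1%R]%classic.
Let mI : measurable I. Proof. exact: measurable_itv. Qed.
Let g (x : mR) : mR := (`|f x| `^ p)%R.
Let v (x : mR) : mR := (`|u x| `^ q)%R.

Let mpow (a : R) (h : mR -> mR) : measurable_fun setT h ->
  measurable_fun setT (fun x : mR => (`|h x| `^ a)%R : mR).
Proof.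
move=> mh; apply: (measurableT_comp (measurable_powR a)).
exact: measurableT_comp.
Qed.

Let mg : measurable_fun setT g. Proof. exact: mpow. Qed.
Let mv : measurable_fun setT v. Proof. exact: mpow. Qed.
Let maff : measurable_fun setT (fun z : mR * mR => (z.1 + r * z.2)%R : mR).
Proof.
apply: measurable_funD; first exact: measurable_fst.
by apply: measurable_funM => //; exact: measurable_snd.
Qed.

Let T1 (z : mR * mR) : mR := (r * (g (z.1 + r * z.2) * m z.2))%R.
Let T2 (z : mR * mR) : mR := (r * (g (z.1 + r * z.2) * v z.1))%R.
Let T3 (z : mR * mR) : mR := (r * (m z.2 * v z.1))%R.

Let mT1 : measurable_fun setT T1.
Proof.
apply: measurable_funM => //; apply: measurable_funM; first exact: measurableT_comp.
by apply: measurableT_comp => //; exact: measurable_snd.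
Qed.
Let mT2 : measurable_fun setT T2.
Proof.
apply: measurable_funM => //; apply: measurable_funM; first exact: measurableT_comp.
by apply: measurableT_comp => //; exact: measurable_fst.
Qed.
Let mT3 : measurable_fun setT T3.
Proof.
apply: measurable_funM => //; apply: measurable_funM.
  by apply: measurableT_comp => //; exact: measurable_snd.
by apply: measurableT_comp => //; exact: measurable_fst.
Qed.

Let g0 x : (0 <= g x)%R. Proof. exact: powR_ge0. Qed.
Let v0 x : (0 <= v x)%R. Proof. exact: powR_ge0. Qed.
Let T10 z : (0 <= T1 z)%R. Proof. exact: mulr_ge0 (ltW r0) (mulr_ge0 (g0 _) (m_ge0 _)). Qed.
Let T20 z : (0 <= T2 z)%R. Proof. exact: mulr_ge0 (ltW r0) (mulr_ge0 (g0 _) (v0 _)). Qed.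
Let T30 z : (0 <= T3 z)%R. Proof. exact: mulr_ge0 (ltW r0) (mulr_ge0 (m_ge0 _) (v0 _)). Qed.

Let le_int_cst (E : set mR) (k : mR -> mR) (N N' : R) : measurable E ->
  measurable_fun setT k -> (forall x, (0 <= k x)%R) ->
  \int[mu]_(x in E) (k x)%:E <= N%:E -> (0 <= N')%R ->
  (\int[mu]_(x in E) ((k x)%:E * N'%:E) <= (N * N')%:E).
Proof.
move=> mE mk k0 kN N0.
rewrite ge0_integralZr //; first by rewrite EFinM lee_wpmul2r.
- by apply/measurable_EFinP; exact: measurable_funTS.
- by move=> x _; rewrite lee_fin.
Qed.

Let IT1 : \int[mu \x mu]_(z in D `*` I) (T1 z)%:E <= (Nm * Nf)%:E.
Proof.
have mET1 : measurable_fun setT (EFin \o T1) by apply/measurable_EFinP.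
rewrite (@tonelli_set21 D I (EFin \o T1)) //.
have mrm : measurable_fun setT (fun y : mR => (r * m y)%R : mR) by exact: measurable_funM.
have rm0 y : (0 <= r * m y)%R by have := m_ge0 y; nonneg.
apply: le_trans (le_int_cst mI mrm rm0 int_m (ltW Nf0)).
apply: ge0_le_integral => //.
- by move=> y _; apply: integral_ge0 => x _; rewrite lee_fin; exact: T10.
- by apply: measurable_funTS; apply: (measurable_int21 mD mET1) => z; rewrite lee_fin; exact: T10.
- by apply: measurable_funTS; apply/measurable_EFinP; apply: measurable_funM.
move=> y _; rewrite /T1 /=.
have -> : \int[mu]_(x in D) (r * (g (x + r * y) * m y))%:E =
   (r * m y)%:E * \int[mu]_(x in D) (g (x + r * y))%:E.
  rewrite -ge0_integralZl_EFin //.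
  - by apply: eq_integral => x _; rewrite -EFinM; congr EFin; ring.
  - by move=> x _; rewrite lee_fin.
  - apply/measurable_EFinP/measurable_funTS/measurableT_comp => //.
    exact: measurable_funD.
apply: lee_wpmul2l; first by rewrite lee_fin.
apply: le_trans int_f; rewrite -(@ge0_integral_affine (r * y)%R 1%R (EFin \o g)) //.
- apply: (@le_trans _ _ (\int[mu]_x (g (x + r * y))%:E)).
    apply: ge0_subset_integral => //; last by move=> x _; rewrite lee_fin.
    apply/measurable_EFinP/measurableT_comp => //; exact: measurable_funD.
  rewrite le_eqVlt; apply/orP; left; apply/eqP; apply: eq_integral => x _.
  by rewrite mul1e mul1r addrC.
- exact/measurable_EFinP.
Qed.

Let IT2 : \int[mu \x mu]_(z in D `*` I) (T2 z)%:E <= (A * Nf)%:E.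
Proof.
have mET2 : measurable_fun setT (EFin \o T2) by apply/measurable_EFinP.
rewrite (@tonelli_set12 D I (EFin \o T2)) //.
apply: le_trans (le_int_cst mD mv v0 int_u (ltW Nf0)).
apply: ge0_le_integral => //.
- by move=> y _; apply: integral_ge0 => x _; rewrite lee_fin; exact: T20.
- by apply: measurable_funTS; apply: (measurable_int12 mI mET2) => z; rewrite lee_fin; exact: T20.
- by apply: measurable_funTS; apply/measurable_EFinP; apply: measurable_funM.
move=> x _; rewrite /T2 /=.
have mgx : measurable_fun setT (fun y : mR => g (x + r * y)%R).
  by apply: measurableT_comp => //; apply: measurable_funD => //; exact: measurable_funM.
have -> : \int[mu]_(y in I) (r * (g (x + r * y) * v x))%:E =
   (v x)%:E * \int[mu]_(y in I) (r%:E * (g (x + r * y))%:E).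
  rewrite -ge0_integralZl_EFin; [|exact: mI| | |exact: v0].
  - by apply: eq_integral => y _; rewrite -!EFinM; congr EFin; ring.
  - by move=> y _; rewrite -EFinM lee_fin mulr_ge0 // ltW.
  - by apply: measurable_funTS; apply/measurable_EFinP; apply: measurable_funM.
apply: lee_wpmul2l; first by rewrite lee_fin.
apply: le_trans int_f; rewrite -(@ge0_integral_affine x r (EFin \o g)) //.
- apply: ge0_subset_integral => //; last by move=> y _; rewrite -EFinM lee_fin mulr_ge0 // ltW.
  by apply/measurable_EFinP; apply: measurable_funM.
- exact/measurable_EFinP.
Qed.

Let IT3 : \int[mu \x mu]_(z in D `*` I) (T3 z)%:E <= (A * Nm)%:E.
Proof.
have mET3 : measurable_fun setT (EFin \o T3) by apply/measurable_EFinP.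
rewrite (@tonelli_set12 D I (EFin \o T3)) //.
apply: le_trans (le_int_cst mD mv v0 int_u (ltW Nm0)).
apply: ge0_le_integral => //.
- by move=> y _; apply: integral_ge0 => x _; rewrite lee_fin; exact: T30.
- by apply: measurable_funTS; apply: (measurable_int12 mI mET3) => z; rewrite lee_fin; exact: T30.
- by apply: measurable_funTS; apply/measurable_EFinP; apply: measurable_funM.
move=> x _; rewrite /T3 /=.
have -> : \int[mu]_(y in I) (r * (m y * v x))%:E = (v x)%:E * \int[mu]_(y in I) (r * m y)%:E.
  rewrite -ge0_integralZl_EFin //.
  - by apply: eq_integral => y _; rewrite -!EFinM; congr EFin; ring.
  - by move=> y _; rewrite lee_fin mulr_ge0 // ltW.
  - by apply: measurable_funTS; apply/measurable_EFinP; apply: measurable_funM.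
by rewrite lee_wpmul2l ?lee_fin.
Qed.

(** Each product in the pointwise bound lacks one of f, u, m. Integrated in the right order, after a
    translation in x or a dilation in y, it splits into two of the masses Nf, Nm, A. Divided by them
    the three integrals are at most 1, and the weights 1/q, th, 1 - 1/p sum to 1. *)
Lemma young_integral :
  \int[mu]_(x in D) \int[mu]_(y in I)
    (r * (m y `^ (1 - th) * `|f (x + r * y)| * `|u x| `^ (q - 1)))%:E <=
  (Nf `^ p^-1 * Nm `^ (1 - th) * A `^ (1 - q^-1))%:E.
Proof.
pose T (z : mR * mR) : mR :=
  (r * (m z.2 `^ (1 - th) * `|f (z.1 + r * z.2)| * `|u z.1| `^ (q - 1)))%R.
have mT : measurable_fun setT T.
  apply: measurable_funM => //; apply: measurable_funM; first apply: measurable_funM.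
  - by apply: (measurableT_comp (measurable_powR (1 - th))); apply: measurableT_comp.
  - by apply: measurableT_comp => //; exact: measurableT_comp.
  - apply: (measurableT_comp (mpow (q - 1) mu_)); exact: measurable_fst.
have T0 z : (0 <= T z)%R by rewrite /T; nonneg.
have mDI : measurable (D `*` I) by exact: measurableX.
have mET : measurable_fun setT (EFin \o T) by apply/measurable_EFinP.
rewrite -(@tonelli_set12 D I (EFin \o T)) //.
pose c := (Nf `^ p^-1 * Nm `^ (1 - th) * A `^ (1 - q^-1))%R.
have c0 : (0 <= c)%R by rewrite /c; nonneg.
have q0 : (0 <= q^-1)%R by rewrite invr_ge0 (le_trans ler01) // ltW.
have pp : (0 <= 1 - p^-1)%R.
  by rewrite subr_ge0 invf_le1 ?(lt_trans ltr01) // ltW.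
pose c1 := (c * (q^-1 / (Nf * Nm)))%R.
pose c2 := (c * (th / (Nf * A)))%R.
pose c3 := (c * ((1 - p^-1) / (Nm * A)))%R.
have c10 : (0 <= c1)%R by rewrite /c1; nonneg.
have c20 : (0 <= c2)%R by rewrite /c2; nonneg.
have c30 : (0 <= c3)%R by rewrite /c3; nonneg.
have mE (h : mR * mR -> mR) : measurable_fun setT h -> measurable_fun (D `*` I) (EFin \o h).
  by move=> mh; apply: measurable_funTS; exact/measurable_EFinP.
have mcE (k : R) (h : mR * mR -> mR) : measurable_fun setT h ->
    measurable_fun (D `*` I) (fun z => k%:E * (h z)%:E).
  move=> mh; apply: measurable_funTS.
  by apply: (measurableT_comp (f := EFin)) => //; apply: measurable_funM.
apply: (@le_trans _ _ (\int[mu \x mu]_(z in D `*` I)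
   (c1%:E * (T1 z)%:E + c2%:E * (T2 z)%:E + c3%:E * (T3 z)%:E))).
  apply: ge0_le_integral => //.
  - by move=> z _; rewrite lee_fin.
  - exact: mE.
  - by apply: emeasurable_funD; [apply: emeasurable_funD|]; exact: mcE.
  move=> [x y] [_ yI]; rewrite -!EFinM -!EFinD lee_fin /T /T1 /T2 /T3 /=.
  have my : (0 < m y)%R by apply: m_gt0; move: yI; rewrite /I /= in_itv.
  have := @young_pointwise p q th (m y) `|f (x + r * y)|%R `|u x|%R Nf Nm A p1 q1 th0 hq
    my (normr_ge0 _) (normr_ge0 _) Nf0 Nm0 A0.
  move=> /(ler_wpM2l (ltW r0)) h; apply: le_trans h _.
  by rewrite le_eqVlt; apply/orP; left; apply/eqP; rewrite /c1 /c2 /c3 /c /g /v; ring.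
rewrite ge0_integralD //; last 4 first.
- by move=> z _; rewrite adde_ge0 // mule_ge0 // lee_fin.
- by apply: emeasurable_funD; exact: mcE.
- by move=> z _; rewrite mule_ge0 // lee_fin.
- exact: mcE.
rewrite ge0_integralD //; last 4 first.
- by move=> z _; rewrite mule_ge0 // lee_fin.
- exact: mcE.
- by move=> z _; rewrite mule_ge0 // lee_fin.
- exact: mcE.
rewrite !ge0_integralZl_EFin //; try (by move=> z _; rewrite lee_fin); try exact: mE.
apply: (@le_trans _ _ (c1%:E * (Nm * Nf)%:E + c2%:E * (A * Nf)%:E + c3%:E * (A * Nm)%:E)).
  by rewrite !leeD // lee_wpmul2l // lee_fin.
rewrite -!EFinM -!EFinD lee_fin le_eqVlt; apply/orP; left; apply/eqP.
rewrite -/c -[RHS]mulr1.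
have <- : (q^-1 + th + (1 - p^-1) = 1)%R by rewrite hq; ring.
rewrite /c1 /c2 /c3 {c10 c20 c30 c1 c2 c3 c0}; move: c (q^-1)%R (p^-1)%R => c' qi pi.
have Nf1 : Nf != 0%R by rewrite gt_eqF.
have Nm1 : Nm != 0%R by rewrite gt_eqF.
have A1 : A != 0%R by rewrite gt_eqF.
by field; rewrite Nf1 Nm1 A1.
Qed.

End YoungIntegral.

End YoungInequality.

(** * Estimates of the kernel *)

Section KernelEstimate.
Context {R : realType}.
Local Notation mu := (@lebesgue_measure R).
Local Notation mR := (measurableTypeR R).
Variables (rho t0 : R).
Hypotheses (rho1 : 1 <= rho) (rho2 : rho < 2).

Ltac rho_lra := generalize rho1 rho2; intros; lra.

(* Dominates the power rho of the Riemann function, up to the logarithmic factor. *)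
Definition kernel_pow (t y : R) : R :=
  expR (- t) `^ (- (rho / 2)) *
    ((expR (- t) - cone_radius t0 t * y) `^ (- (rho / 2)) +
     (expR (- t) + cone_radius t0 t * y) `^ (- (rho / 2))).

Lemma kernel_pow_ge0 t y : 0 <= kernel_pow t y.
Proof. by rewrite /kernel_pow; nonneg. Qed.

Lemma powR_anti (x y r : R) : 0 < x -> x <= y -> r <= 0 -> y `^ r <= x `^ r.
Proof.
move=> x0 xy r0; have y0 : 0 < y by exact: lt_le_trans xy.
rewrite -[r]opprK !(powRN _ (- r)) lef_pV2 ?posrE ?powR_gt0 //.
by rewrite ge0_ler_powR ?nnegrE ?oppr_ge0 // ltW.
Qed.

Lemma cone_radius_ge0 t : t <= t0 -> 0 <= cone_radius t0 t.
Proof. by move=> tt0; rewrite /cone_radius subr_ge0 ler_expR lerN2. Qed.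

Let side (t y : R) : t <= t0 -> - 1 <= y <= 1 ->
  0 < expR (- t) - cone_radius t0 t * y /\ 0 < expR (- t) + cone_radius t0 t * y.
Proof.
move=> tt0 /andP[y1 y2]; have ph0 := cone_radius_ge0 tt0; have b0 := expR_gt0 (- t0).
have -> : expR (- t) = cone_radius t0 t + expR (- t0) by rewrite /cone_radius; ring.
have h1 : 0 <= cone_radius t0 t * (1 - y) by rewrite mulr_ge0 // subr_ge0.
have h2 : 0 <= cone_radius t0 t * (1 + y) by rewrite mulr_ge0 //; lra.
by split; lra.
Qed.

Lemma kernel_pow_gt0 t y : t <= t0 -> - 1 <= y <= 1 -> 0 < kernel_pow t y.
Proof.
move=> tt0 y1; have [s1 s2] := side tt0 y1.
by rewrite /kernel_pow mulr_gt0 ?addr_gt0 // powR_gt0 // expR_gt0.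
Qed.

Let powRV (d : R) : 0 < d -> (d `^ (- (rho / 2))) `^ (rho^-1) = (Num.sqrt d)^-1.
Proof.
move=> d0; rewrite -powRrM (_ : - (rho / 2) * rho^-1 = - 2^-1); last by field; rho_lra.
by rewrite powRN powR12_sqrt // ltW.
Qed.

Let kernel_pow_lb (t y d : R) : t <= t0 -> - 1 <= y <= 1 ->
  d = expR (- t) - cone_radius t0 t * y \/ d = expR (- t) + cone_radius t0 t * y ->
  (Num.sqrt (expR (- t) * d))^-1 <= kernel_pow t y `^ (rho^-1).
Proof.
move=> tt0 y1 hd; have [s1 s2] := side tt0 y1; have a0 := expR_gt0 (- t).
have d0 : 0 < d by case: hd => ->.
rewrite -powRV ?mulr_gt0 //.
have r0 : 0 <= rho^-1 by rewrite invr_ge0; rho_lra.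
rewrite ge0_ler_powR ?nnegrE ?powR_ge0 ?kernel_pow_ge0 //.
rewrite powRM ?(ltW a0) ?(ltW d0) // /kernel_pow ler_wpM2l ?powR_ge0 //.
by case: hd => ->; [rewrite lerDl|rewrite lerDr]; exact: powR_ge0.
Qed.

(** The logarithm is controlled by Z <= cosh (t0 - t) <= e^{t0 - t}. For the root, Z >= e^{t + t0}
    (e^{-2t} - x^2) / 2, and e^{-2t} - x^2 >= e^{-t} d with d = e^{-t} - |x|. The sign of x decides
    which summand of [kernel_pow] carries d; keeping both avoids the absolute value. *)
Lemma riemann_fun_le (p0 : R -> R) (C t y : R) : 0 <= C ->
  (forall Z, 1 <= Z -> `|p0 Z| * Num.sqrt Z <= C * (1 + ln Z)) ->
  t <= t0 -> - 1 <= y <= 1 ->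
  `|riemann_fun p0 t0 (cone_radius t0 t * y) t| <=
    2 * C * (1 + (t0 - t)) * kernel_pow t y `^ (rho^-1).
Proof.
move=> C0 bnd tt0 y1.
set x := cone_radius t0 t * y; set Z := cone_arg t0 x t.
have [s1 s2] := side tt0 y1; rewrite -/x in s1 s2.
have a0 := expR_gt0 (- t); have r0 := expR_gt0 t; have Q0 := expR_gt0 t0.
have phi0 := cone_radius_ge0 tt0.
have y2 : 0 <= 1 - y ^+ 2 by case/andP: y1 => h1 h2; nra.
have ZE : Z = 1 + 2^-1 * cone_radius t0 t ^+ 2 * expR t * expR t0 * (1 - y ^+ 2).
  exact: cone_argE.
have c0 : 0 <= 2^-1 * cone_radius t0 t ^+ 2 * expR t * expR t0 by nonneg.
have Z1 : 1 <= Z by rewrite ZE lerDl mulr_ge0.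
have Zs : Z <= expR (t0 - t).
  have : Z <= 1 + 2^-1 * cone_radius t0 t ^+ 2 * expR t * expR t0.
    rewrite ZE lerD2l ler_piMr //; have := sqr_ge0 y; lra.
  have -> : 1 + 2^-1 * cone_radius t0 t ^+ 2 * expR t * expR t0 =
      2^-1 * (expR (t0 - t) + expR (t - t0)).
    rewrite /cone_radius !expRD !expRN.
    have h : expR t != 0 by rewrite gt_eqF.
    have h0 : expR t0 != 0 by rewrite gt_eqF.
    by field; apply/andP.
  have : expR (t - t0) <= expR (t0 - t) by rewrite ler_expR; lra.
  lra.
have Z0 : 0 < Z by lra.
have lnZ : ln Z <= t0 - t by rewrite -ler_expR lnK.
have q0 : 0 < Num.sqrt Z by rewrite sqrtr_gt0.
have pb : `|p0 Z| <= C * (1 + (t0 - t)) / Num.sqrt Z.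
  rewrite ler_pdivlMr //; apply: le_trans (bnd Z Z1) _.
  by rewrite ler_wpM2l // lerD2l.
have [d [hd d0 dE]] : exists d, [/\ d = expR (- t) - x \/ d = expR (- t) + x, 0 < d &
    expR (- t) * d <= expR (- t) ^+ 2 - x ^+ 2].
  have [x0|/ltW x0] := leP 0 x.
    exists (expR (- t) - x); split; [by left|by []|].
    by rewrite [leRHS](_ : _ = (expR (- t) + x) * (expR (- t) - x)); [rewrite ler_wpM2r; lra|ring].
  exists (expR (- t) + x); split; [by right|by []|].
  by rewrite [leRHS](_ : _ = (expR (- t) - x) * (expR (- t) + x)); [rewrite ler_wpM2r; lra|ring].
have lb := kernel_pow_lb tt0 y1 hd.
set k := expR (2^-1 * (t + t0)).
have k0 : 0 < k by exact: expR_gt0.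
have kZ : k / Num.sqrt Z <= 2 / Num.sqrt (expR (- t) * d).
  set S := Num.sqrt (expR (- t) * d).
  have S0 : 0 < S by rewrite sqrtr_gt0 mulr_gt0.
  have SS : S ^+ 2 = expR (- t) * d by rewrite sqr_sqrtr // ltW // mulr_gt0.
  have qq : Num.sqrt Z ^+ 2 = Z by rewrite sqr_sqrtr // ltW.
  have kk : k ^+ 2 = expR t * expR t0 by rewrite /k -expRM_natl -expRD; congr expR; field.
  rewrite ler_pdivrMr // mulrAC ler_pdivlMr //.
  have : (k * S) ^+ 2 <= (2 * Num.sqrt Z) ^+ 2.
    rewrite !exprMn SS qq kk.
    have -> : Z = 2^-1 * (expR (- t) ^+ 2 + expR (- t0) ^+ 2 - x ^+ 2) * (expR t * expR t0).
      rewrite /Z /cone_arg !expRN.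
      have h : expR t != 0 by rewrite gt_eqF.
      have h0 : expR t0 != 0 by rewrite gt_eqF.
      by field; apply/andP.
    rewrite mulrC (mulrA (2 ^+ 2)) ler_wpM2r ?mulr_ge0 ?(ltW r0) ?(ltW Q0) //.
    have := sqr_ge0 (expR (- t0)); have := mulr_gt0 a0 d0; lra.
  by rewrite ler_pXn2r // nnegrE; nonneg.
rewrite /riemann_fun -/k -/x -/Z normrM (gtr0_norm k0).
apply: le_trans (ler_wpM2l (ltW k0) pb) _.
rewrite (_ : _ * (_ / _) = C * (1 + (t0 - t)) * (k / Num.sqrt Z)); last by ring.
rewrite (_ : 2 * C * _ * _ = C * (1 + (t0 - t)) * (2 * kernel_pow t y `^ rho^-1)); last by ring.
have c1 : 0 <= C * (1 + (t0 - t)) by rewrite mulr_ge0 //; lra.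
rewrite ler_wpM2l //; apply: le_trans kZ _.
by rewrite ler_wpM2l.
Qed.

Let al := 1 - rho / 2.
Let al0 : 0 < al. Proof. by rewrite /al; rho_lra. Qed.

(** The explicit primitive has exponent 1 - rho/2, positive since rho < 2, so the growth of the
    kernel towards the sides of the cone is paid for uniformly in t0. *)
Lemma kernel_pow_mass t : t < t0 ->
  (\int[mu]_(y in `[(- 1)%R, 1%R]) (cone_radius t0 t * kernel_pow t y)%:E <=
   (4 / (1 - rho / 2) * cone_radius t0 t * expR (- t) `^ (- rho))%:E)%E.
Proof.
move=> tt0; have tt := ltW tt0.
set a := expR (- t); set ph := cone_radius t0 t.
have a0 : 0 < a by exact: expR_gt0.
have ph0 : 0 < ph by rewrite /ph /cone_radius subr_gt0 ltr_expR ltrN2.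
have pha : ph < a by rewrite /ph /cone_radius ltrBlDr ltrDl expR_gt0.
pose G (y : R) := a `^ (- (rho / 2)) * al^-1 * ((a + ph * y) `^ al - (a - ph * y) `^ al).
have dG (y : R) : - 1 <= y <= 1 -> is_derive y 1 G (ph * kernel_pow t y).
  move=> y1; have [s1 s2] := side tt y1.
  have d1 := is_derive1_powR al s1; have d2 := is_derive1_powR al s2.
  have e1 : is_derive y 1 (fun y => a - ph * y) (- ph) by solve_is_derive ltac:(ring).
  have e2 : is_derive y 1 (fun y => a + ph * y) ph by solve_is_derive ltac:(ring).
  have f1 := @der_comp R (@powR R ^~ al) (fun y => a - ph * y) y _ _ d1 e1.
  have f2 := @der_comp R (@powR R ^~ al) (fun y => a + ph * y) y _ _ d2 e2.
  rewrite /G; solve_is_derive ltac:(idtac).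
  have ale : al - 1 = - (rho / 2) by rewrite /al; ring.
  rewrite /kernel_pow -/a -/ph ale.
  by field; rewrite (gt_eqF al0).
have dK (y : R) : - 1 <= y <= 1 -> {for y, continuous (fun y => ph * kernel_pow t y)}.
  move=> y1; have [s1 s2] := side tt y1.
  have d1 := is_derive1_powR (- (rho / 2)) s1; have d2 := is_derive1_powR (- (rho / 2)) s2.
  have e1 : is_derive y 1 (fun y => a - ph * y) (- ph) by solve_is_derive ltac:(ring).
  have e2 : is_derive y 1 (fun y => a + ph * y) ph by solve_is_derive ltac:(ring).
  have f1 := @der_comp R (@powR R ^~ (- (rho / 2))) (fun y => a - ph * y) y _ _ d1 e1.
  have f2 := @der_comp R (@powR R ^~ (- (rho / 2))) (fun y => a + ph * y) y _ _ d2 e2.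
  by rewrite /kernel_pow; notypeclasses refine (is_derive_continuous _); repeat der_step.
have n11 : - 1 < 1 :> R by lra.
rewrite (@continuous_FTC2 R _ G _ _ n11); last 3 first.
- apply: continuous_in_subspaceT => y; rewrite inE /= in_itv /=; exact: dK.
- split=> [y||].
  + by rewrite in_itv /= => /andP[/ltW h1 /ltW h2]; have [] := dG y (introT andP (conj h1 h2)).
  + by apply: cvg_at_right_filter; apply: (is_derive_continuous (dG _ _)); lra.
  + by apply: cvg_at_left_filter; apply: (is_derive_continuous (dG _ _)); lra.
- move=> y; rewrite in_itv /= => /andP[/ltW h1 /ltW h2].
  by rewrite derive1E; have [_ ->] := dG y (introT andP (conj h1 h2)).
rewrite -EFinB lee_fin /G !mulr1 !mulrN1 opprK.
have am : a `^ (- rho) = a `^ (- (rho / 2)) * a `^ (- (rho / 2)).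
  rewrite -powRD; last by rewrite (gt_eqF a0) implybT.
  by congr (a `^ _); field.
rewrite am; set w := a `^ (- (rho / 2)).
have w0 : 0 < w by rewrite powR_gt0.
have split_pow (x : R) : 0 < x -> x `^ al = x * x `^ (- (rho / 2)).
  move=> x0; rewrite (_ : al = 1 + - (rho / 2)); last by rewrite /al; ring.
  rewrite powRD; last by rewrite (gt_eqF x0) implybT.
  by rewrite powRr1 // ltW.
(* Writing x^al = x x^(-rho/2) and comparing the second factor with its value at [a] bounds the
   difference of the two powers by 2 ph w. The linear factor ph must survive: it becomes (e^{t0-t} -
   1)^{1/rho}. *)
have up : (a + ph) `^ al <= (a + ph) * w.
  have s3 : 0 < a + ph by lra.
  rewrite (split_pow _ s3); apply: ler_wpM2l; first exact: ltW.
  by apply: powR_anti => //; rho_lra.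
have dn : (a - ph) * w <= (a - ph) `^ al.
  have s3 : 0 < a - ph by lra.
  rewrite (split_pow _ s3); apply: ler_wpM2l; first exact: ltW.
  by apply: powR_anti => //; rho_lra.
rewrite (_ : _ - _ = w / al * (2 * ((a + ph) `^ al - (a - ph) `^ al))); last by field; rewrite (gt_eqF al0).
rewrite (_ : 4 / _ * _ * _ = w / al * (4 * ph * w)); last by rewrite /al; ring.
by rewrite ler_wpM2l ?divr_ge0 ?(ltW w0) ?(ltW al0) //; lra.
Qed.

End KernelEstimate.

(** * Contribution of a single source time *)

Section PerTimeEstimate.
Context {R : realType}.
Local Notation mu := (@lebesgue_measure R).
Local Notation mR := (measurableTypeR R).

Definition time_weight (rho t0 t : R) : R :=
  expR (t0 * (1 - 1 / rho)) *
    ((1 + t0 - t) * (expR (t0 - t) - 1) `^ (1 / rho) * (expR (t0 - t) + 1)^-1).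

Lemma time_weight_ge0 (rho t0 t : R) : t <= t0 -> 0 <= time_weight rho t0 t.
Proof.
move=> tt0; have st : 0 <= 1 + t0 - t by lra.
by rewrite /time_weight; nonneg.
Qed.

Lemma time_weight_gt0 (rho t0 t : R) : t < t0 -> 0 < time_weight rho t0 t.
Proof.
move=> tt0; have st : 0 < 1 + t0 - t by lra.
have e1 : 0 < expR (t0 - t) - 1 by rewrite subr_gt0 -expR0 ltr_expR; lra.
rewrite /time_weight mulr_gt0 ?expR_gt0 // mulr_gt0 //.
by rewrite mulr_gt0 // powR_gt0.
Qed.

(** The radius is e^{-t0} (e^{t0-t} - 1), whose root of order rho yields e^{-t0/rho}; the power of
    e^{-t} becomes e^t, and [key] trades it for e^{t0} over e^{t0-t} + 1 at the cost of a factor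
    2. *)
Lemma kernel_mass_le_weight (rho t0 t C : R) : 1 <= rho -> rho < 2 -> t < t0 -> 0 <= C ->
  2 * C * (1 + (t0 - t)) *
    (4 / (1 - rho / 2) * cone_radius t0 t * expR (- t) `^ (- rho)) `^ (rho^-1) <=
  4 * C * (4 / (1 - rho / 2)) `^ (rho^-1) * time_weight rho t0 t.
Proof.
move=> rho1 rho2 tt0 C0.
have e0 : 0 < cone_radius t0 t by rewrite /cone_radius subr_gt0 ltr_expR ltrN2.
have k0 : 0 <= 4 / (1 - rho / 2) by rewrite divr_ge0 //; lra.
move: (4 / (1 - rho / 2)) k0 => kk k0.
have s0 : 0 <= expR (t0 - t) - 1 by rewrite subr_ge0 -expR0 ler_expR; lra.
have phE : cone_radius t0 t = expR (- t0) * (expR (t0 - t) - 1).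
  rewrite /cone_radius mulrBr mulr1 -expRD; congr (expR _ - _); ring.
have ph0 := ltW e0.
rewrite powRM ?powR_ge0 ?mulr_ge0 // [(kk * _) `^ _]powRM //.
rewrite -powRrM mulNr divff; last by lra.
rewrite powR_inv1 ?expR_ge0 // phE powRM ?expR_ge0 // /time_weight div1r.
set g := _ `^ rho^-1; set w := (expR (t0 - t) - 1) `^ rho^-1.
have g0 : 0 <= g by exact: powR_ge0.
have w0 : 0 <= w by exact: powR_ge0.
rewrite -expRM.
have -> : (expR (- t))^-1 = expR t by rewrite expRN invrK.
have -> : t0 * (1 - rho^-1) = t0 + - t0 * rho^-1 by ring.
rewrite expRD; set v := expR (- t0 * rho^-1).
have v0 : 0 <= v by exact: expR_ge0.
have key : expR t <= 2 * (expR t0 / (expR (t0 - t) + 1)).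
  have d0 : 0 < expR (t0 - t) + 1 by have := expR_gt0 (t0 - t); lra.
  rewrite mulrA ler_pdivlMr // mulrDr mulr1 -expRD (_ : t + (t0 - t) = t0); last by ring.
  have : expR t <= expR t0 by rewrite ler_expR ltW.
  lra.
have st : 0 <= 1 + (t0 - t) by lra.
have c0 : 0 <= 2 * C * (1 + (t0 - t)) * g * v * w by nonneg.
have := ler_wpM2l c0 key; congr (_ <= _); rewrite -?[1 + t0 - t]addrA; ring.
Qed.


Variables (rho p q t0 t C1 A : R) (p0 : R -> R) (f u : mR -> mR) (D : set mR).
Hypotheses (rho1 : 1 <= rho) (rho2 : rho < 2) (p1 : 1 < p) (q1 : 1 < q).
Hypothesis hq : q^-1 = p^-1 - (1 - rho^-1).
Ltac rho_lra := generalize rho1 rho2; intros; lra.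
Hypotheses (C10 : 0 < C1) (A0 : 0 < A) (tt0 : t <= t0).
Hypothesis cp0 : continuous p0.
Hypothesis bnd : forall Z : R, 1 <= Z -> `|p0 Z| * Num.sqrt Z <= C1 * (1 + ln Z).
Hypotheses (mf : measurable_fun setT f) (mu_ : measurable_fun setT u) (mD : measurable D).
Hypothesis int_u : (\int[mu]_(x in D) (`|u x| `^ q)%:E <= A%:E)%E.

Let ph := cone_radius t0 t.
Let Phi (z : mR * mR) : mR :=
  `|ph * riemann_fun p0 t0 (ph * z.2) t * f (z.1 + ph * z.2)| * `|u z.1| `^ (q - 1).
Let Y (z : mR * mR) : mR :=
  ph * (kernel_pow rho t0 t z.2 `^ (rho^-1) * `|f (z.1 + ph * z.2)| * `|u z.1| `^ (q - 1)).
Let I : set mR := `[(- 1)%R, 1%R]%classic.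

Let maff (s : mR) : measurable_fun setT (fun y : mR => s + ph * y : mR).
Proof. by apply: measurable_funD => //; apply: measurable_funM. Qed.

Let mkernel : measurable_fun setT (kernel_pow rho t0 t : mR -> mR).
Proof.
rewrite /kernel_pow; apply: measurable_funM => //; apply: measurable_funD.
  apply: (measurableT_comp (measurable_powR _)).
  by apply: measurable_funB => //; exact: measurable_funM.
apply: (measurableT_comp (measurable_powR _)); exact: maff.
Qed.

Let mriem : measurable_fun setT (fun y : mR => riemann_fun p0 t0 (ph * y) t : mR).
Proof.
apply: continuous_measurable_fun; rewrite /riemann_fun /cone_arg.
apply: contM; first exact: cont_cst.
apply: (cont_comp cp0); apply: contM; first exact: cont_cst.
apply: contD; first exact: cont_cst.
by apply: contN; do 2 (apply: contM; last exact: cont_cst); apply: contX; apply: contM; [exact: cont_cst|exact: cont_id].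
Qed.

Let mfaff : measurable_fun setT (fun z : mR * mR => f (z.1 + ph * z.2) : mR).
Proof.
apply: measurableT_comp => //; apply: measurable_funD; first exact: measurable_fst.
by apply: measurable_funM => //; exact: measurable_snd.
Qed.

Let mupow : measurable_fun setT (fun z : mR * mR => `|u z.1| `^ (q - 1) : mR).
Proof.
apply: (measurableT_comp (measurable_powR (q - 1))); apply: measurableT_comp => //.
by apply: (measurableT_comp mu_); exact: measurable_fst.
Qed.

Let mPhi : measurable_fun setT Phi.
Proof.
apply: measurable_funM => //; apply: measurableT_comp => //; apply: measurable_funM => //.
apply: measurable_funM => //; apply: (measurableT_comp mriem); exact: measurable_snd.
Qed.

Let mY : measurable_fun setT Y.
Proof.
apply: measurable_funM => //; apply: measurable_funM => //; apply: measurable_funM.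
  apply: (measurableT_comp (measurable_powR _)); apply: (measurableT_comp mkernel).
  exact: measurable_snd.
exact: measurableT_comp.
Qed.

Let ph_ge0 : 0 <= ph. Proof. exact: cone_radius_ge0. Qed.
Let Phi0 z : 0 <= Phi z. Proof. by rewrite /Phi; nonneg. Qed.
Let Y0 z : 0 <= Y z.
Proof. by rewrite /Y; apply: mulr_ge0; [exact: ph_ge0|nonneg]. Qed.

Let al0 : 0 < 4 / (1 - rho / 2). Proof. by rewrite divr_gt0 //; rho_lra. Qed.
Let K := 4 * C1 * (4 / (1 - rho / 2)) `^ (rho^-1).

Let finite_case (N : R) : t < t0 -> 0 < N -> (\int[mu]_x (`|f x| `^ p)%:E <= N%:E)%E ->
  (\int[mu]_(x in D) \int[mu]_(y in I) (Phi (x, y))%:E <=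
   (K * time_weight rho t0 t * N `^ p^-1 * A `^ (1 - q^-1))%:E)%E.
Proof.
move=> tt N0 fN.
have ph0 : 0 < ph by rewrite /ph /cone_radius subr_gt0 ltr_expR ltrN2.
pose Nm := 4 / (1 - rho / 2) * ph * expR (- t) `^ (- rho).
have Nm0 : 0 < Nm := mulr_gt0 (mulr_gt0 al0 ph0) (powR_gt0 _ (expR_gt0 _)).
have th0 : 0 <= 1 - rho^-1 by rewrite subr_ge0 invf_le1 //; rho_lra.
have km0 y : - 1 <= y <= 1 -> 0 < kernel_pow rho t0 t y.
  exact: kernel_pow_gt0 tt0.
have yi := young_integral p1 q1 th0 hq ph0 N0 Nm0 A0 mf mu_ mkernel mD
  (kernel_pow_ge0 rho t0 t) km0 fN (kernel_pow_mass rho1 rho2 tt) int_u.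
rewrite (_ : 1 - (1 - rho^-1) = rho^-1) in yi; last by ring.
pose c := 2 * C1 * (1 + (t0 - t)).
have c0 : 0 <= c by rewrite /c; apply: mulr_ge0; [apply: mulr_ge0 => //; exact: ltW|rewrite addr_ge0 // subr_ge0].
have mI : measurable I by exact: measurable_itv.
have mDI : measurable (D `*` I) by exact: measurableX.
have mEPhi : measurable_fun setT (EFin \o Phi) by apply/measurable_EFinP.
have mEY : measurable_fun setT (EFin \o Y) by apply/measurable_EFinP.
rewrite -(@tonelli_set12 _ D I (EFin \o Phi)) //.
apply: (@le_trans _ _ (\int[mu \x mu]_(z in D `*` I) (c%:E * (Y z)%:E))%E).
  apply: ge0_le_integral => //.
  - by move=> z _; rewrite lee_fin.
  - exact: measurable_funTS.
  - by apply: measurable_funTS; apply/measurable_EFinP; apply: measurable_funM.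
  move=> [x y] [_ yI]; rewrite -EFinM lee_fin /Phi /Y /=.
  have y1 : - 1 <= y <= 1 by move: yI; rewrite /I /= in_itv.
  have h := riemann_fun_le rho1 rho2 (ltW C10) bnd tt0 y1.
  rewrite -/ph -/c in h.
  rewrite [`|_ * f _|]normrM [`|ph * _|]normrM (ger0_norm ph_ge0) !mulrA.
  rewrite ler_wpM2r ?powR_ge0 // ler_wpM2r //.
  by rewrite (mulrC c) -mulrA ler_wpM2l.
rewrite ge0_integralZl_EFin //; last 2 first.
- by move=> z _; rewrite lee_fin.
- exact: measurable_funTS.
rewrite (@tonelli_set12 _ D I (EFin \o Y)) //.
apply: (@le_trans _ _ (c%:E * (N `^ p^-1 * Nm `^ rho^-1 * A `^ (1 - q^-1))%:E)%E).
  by apply: lee_wpmul2l; rewrite ?lee_fin.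
rewrite -EFinM lee_fin.
have kw := kernel_mass_le_weight rho1 rho2 tt (ltW C10).
rewrite -/ph -/Nm -/c -/K in kw.
rewrite (_ : c * _ = c * Nm `^ rho^-1 * (N `^ p^-1 * A `^ (1 - q^-1))); last by ring.
rewrite -(mulrA (K * _)) ler_wpM2r ?mulr_ge0 ?powR_ge0 //.
Qed.

(** Young's normalisation divides by the masses, so degenerate cases are separated: at t = t0 the
    radius and hence the left side vanish; an infinite norm of f makes the right side infinite; a
    zero norm is reached through small positive N. *)
Lemma per_time_estimate :
  (\int[mu]_(x in D) \int[mu]_(y in I) (Phi (x, y))%:E <=
   (K * time_weight rho t0 t * A `^ (1 - q^-1))%:E * 'N[mu]_(p%:E)[EFin \o f])%E.
Proof.
have pn0 : p^-1 != 0 by rewrite invr_eq0 gt_eqF // (lt_trans ltr01).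
have p0' : 0 < p^-1 by rewrite invr_gt0 (lt_trans ltr01).
have [tt|/eqP te] : t < t0 \/ t == t0.
  by move: tt0; rewrite le_eqVlt => /orP[]; [right|left].
  have W0 : 0 < K * time_weight rho t0 t * A `^ (1 - q^-1).
    apply: mulr_gt0 (powR_gt0 _ A0); apply: mulr_gt0 (time_weight_gt0 _ tt).
    exact: mulr_gt0 (mulr_gt0 _ C10) (powR_gt0 _ al0).
  set c := K * _ * _ in W0 *.
  have NE : ('N[mu]_(p%:E)[EFin \o f] = (\int[mu]_x (`|f x| `^ p)%:E) `^ p^-1)%E.
    by rewrite unlock.
  rewrite NE.
  have F0 : (0 <= \int[mu]_x (`|f x| `^ p)%:E)%E.
    by apply: integral_ge0 => x _; rewrite lee_fin powR_ge0.
  case FE : (\int[mu]_x (`|f x| `^ p)%:E)%E F0 => [N| |] //.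
    rewrite lee_fin le_eqVlt => /predU1P[N0|N0].
      rewrite -N0 poweR0r // mule0.
      apply/lee_addgt0Pr => e e0; rewrite add0e.
      (* With this upper bound for the vanishing integral, the estimate reads c d^{1/p} = e. *)
      pose d := (e / c) `^ p.
      have d0 : 0 < d by rewrite powR_gt0 // divr_gt0.
      have := finite_case tt d0; rewrite FE lee_fin -N0 => /(_ (ltW d0)).
      rewrite /d -powRrM divff ?gt_eqF ?(lt_trans ltr01) // powRr1; last by rewrite divr_ge0 // ltW.
      by rewrite [X in (_ <= X%:E)%E -> _](_ : _ = e) //; rewrite mulrAC -/c mulrC divfK // gt_eqF.
    have := finite_case tt N0; rewrite FE lexx => /(_ isT).
    by rewrite poweR_EFin -EFinM mulrAC.
  by move=> _; rewrite poweRyr // gt0_muley ?lte_fin // leey.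
have ph0 : ph = 0 by rewrite /ph te /cone_radius subrr.
rewrite [X in (X <= _)%E]integral0_eq; last first.
  by move=> x _; apply: integral0_eq => y _; rewrite /Phi ph0 !mul0r normr0 mul0r.
rewrite mule_ge0 ?Lnorm_ge0 // lee_fin.
apply: mulr_ge0 (powR_ge0 _ _); apply: mulr_ge0 (time_weight_ge0 _ tt0).
exact: mulr_ge0 (mulr_ge0 _ (ltW C10)) (powR_ge0 _ _).
Qed.

End PerTimeEstimate.

(** * The estimate *)

Section LpLqEstimate.
Context {R : realType}.
Local Notation mu := (@lebesgue_measure R).
Local Notation mR := (measurableTypeR R).
Variables (M : R) (p0 p1 p2 : R -> R).
Hypotheses (cp0 : continuous p0) (cp1 : continuous p1) (cp2 : continuous p2).
Hypothesis p01 : p0 1 = 1.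
Hypothesis legp : forall Z : R, 2^-1 < Z ->
  [/\ is_derive Z 1 p0 (p1 Z), is_derive Z 1 p1 (p2 Z) &
      (Z ^+ 2 - 1) * p2 Z + 2 * Z * p1 Z + (M ^+ 2 + 4^-1) * p0 Z = 0].
Variables (C1 rho p q : R).
Hypotheses (C10 : 0 < C1) (rho1 : 1 <= rho) (rho2 : rho < 2) (p1' : 1 < p) (q1 : 1 < q).
Hypothesis hq : q^-1 = p^-1 - (1 - rho^-1).
Hypothesis bnd : forall Z : R, 1 <= Z -> `|p0 Z| * Num.sqrt Z <= C1 * (1 + ln Z).
Variables (U Ux Ut Uxx Utx Utt F : R -> R -> R).
Hypothesis cdata : cauchy_data M U Ux Ut Uxx Utx Utt F.
Variables (t0 a b : R).
Hypotheses (t0pos : 0 < t0) (ab : a <= b).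

Let K := 4 * C1 * (4 / (1 - rho / 2)) `^ (rho^-1).
Let D : set mR := `[a, b]%classic.
Let I : set mR := `[(- 1)%R, 1%R]%classic.
Let J : set mR := `[0%R, t0]%classic.
Let mD : measurable D. Proof. exact: measurable_itv. Qed.
Let mI : measurable I. Proof. exact: measurable_itv. Qed.
Let mJ : measurable J. Proof. exact: measurable_itv. Qed.

Let ker (z : mR * mR) : mR :=
  cone_radius t0 z.1 * riemann_fun p0 t0 (cone_radius t0 z.1 * z.2) z.1.
Let g (x t y : mR) : mR := `|ker (t, y) * F (x + cone_radius t0 t * y) t|.
Let Phi (z : (mR * mR) * mR) : mR := g z.1.1 z.1.2 z.2 * `|U z.1.1 t0| `^ (q - 1).

Let mU : measurable_fun setT (fun x : mR => U x t0 : mR).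
Proof.
apply: continuous_measurable_fun.
by apply: (jcont_comp (cd_U cdata)); [exact: cont_id|exact: cont_cst].
Qed.

Let mF : measurable_fun setT (fun z : mR * mR => F z.1 z.2 : mR).
Proof. exact: continuous_measurable_prod (cd_F cdata). Qed.

Let mFt (t : mR) : measurable_fun setT (fun x : mR => F x t : mR).
Proof.
apply: continuous_measurable_fun.
by apply: (jcont_comp (cd_F cdata)); [exact: cont_id|exact: cont_cst].
Qed.

Let mrad : measurable_fun setT (fun t : mR => cone_radius t0 t : mR).
Proof.
apply: continuous_measurable_fun; rewrite /cone_radius.
by apply: contD; [apply: cont_expR; apply: contN; exact: cont_id|exact: cont_cst].
Qed.

Let mker : measurable_fun setT ker.
Proof.
apply: continuous_measurable_prod; rewrite /ker /riemann_fun /cone_arg /cone_radius.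
have c1 : continuous (fun z : R * R => expR (- z.1) - expR (- t0)).
  by apply: contD; [apply: cont_expR; apply: contN; exact: cont_fst|exact: cont_cst].
apply: contM => //; apply: contM.
  by apply: cont_expR; apply: contM; [exact: cont_cst|apply: contD; [exact: cont_fst|exact: cont_cst]].
apply: (cont_comp cp0); apply: contM; first exact: cont_cst.
apply: contD.
  apply: contD; apply: contM; try exact: cont_cst; apply: cont_expR; last exact: cont_fst.
  by apply: contN; exact: cont_fst.
apply: contN; apply: contM; last exact: cont_cst.
apply: contM; last by apply: cont_expR; exact: cont_fst.
by apply: contX; apply: contM => //; exact: cont_snd.
Qed.

Let mPhi : measurable_fun setT Phi.
Proof.
have m1 : measurable_fun setT (fun z : (mR * mR) * mR => z.1.1 : mR).
  by apply: (measurableT_comp measurable_fst); exact: measurable_fst.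
have m2 : measurable_fun setT (fun z : (mR * mR) * mR => z.1.2 : mR).
  by apply: (measurableT_comp measurable_snd); exact: measurable_fst.
have m3 : measurable_fun setT (fun z : (mR * mR) * mR => z.2 : mR) by exact: measurable_snd.
apply: measurable_funM; last first.
  apply: (measurableT_comp (measurable_powR (q - 1))); apply: measurableT_comp => //.
  exact: (measurableT_comp mU).
apply: measurableT_comp => //; apply: measurable_funM.
  apply: (measurableT_comp mker); exact: measurable_fun_pair.
apply: (measurableT_comp mF
  (g := fun z : (mR * mR) * mR => (z.1.1 + cone_radius t0 z.1.2 * z.2, z.1.2))).
apply: measurable_fun_pair => //.
apply: measurable_funD => //; apply: measurable_funM => //.
exact: (measurableT_comp mrad).
Qed.

Let Phi0 z : 0 <= Phi z. Proof. by rewrite /Phi /g; nonneg. Qed.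

Let Jf (z : mR * mR) : \bar R := (\int[mu]_(y in I) (Phi (z, y))%:E)%E.

Let mJf : measurable_fun setT Jf.
Proof.
have mE : measurable_fun setT (EFin \o Phi) by apply/measurable_EFinP.
exact: (measurable_int12 mI mE).
Qed.

Let Jf0 z : (0 <= Jf z)%E.
Proof. by apply: integral_ge0 => y _; rewrite lee_fin. Qed.

(** Duhamel's bound multiplied by |u|^{q-1}, the dual weight that Young's inequality is tested
    against. The factor 2 is given away. *)
Let representation (x : R) :
  ((`|U x t0| `^ q)%:E <= \int[mu]_(t in J) Jf (x, t))%E.
Proof.
have rb := riemann_bound cp0 cp1 cp2 p01 legp cdata x t0pos.
pose h := `|U x t0| `^ (q - 1).
have h0 : 0 <= h by exact: powR_ge0.
have mgx : measurable_fun setT (fun z : mR * mR => g x z.1 z.2 : mR).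
  apply: measurableT_comp => //; apply: measurable_funM.
    by apply: (measurableT_comp mker); apply: measurable_fun_pair;
      [exact: measurable_fst|exact: measurable_snd].
  apply: (measurableT_comp mF
    (g := fun z : mR * mR => (x + cone_radius t0 z.1 * z.2, z.1))).
  apply: measurable_fun_pair; last exact: measurable_fst.
  apply: measurable_funD => //; apply: measurable_funM; last exact: measurable_snd.
  by apply: (measurableT_comp mrad); exact: measurable_fst.
have g0 t y : 0 <= g x t y by exact: normr_ge0.
have JE t : Jf (x, t) = (h%:E * \int[mu]_(y in I) (g x t y)%:E)%E.
  rewrite -ge0_integralZl_EFin; [|exact: mI| | |exact: h0].
  - by apply: eq_integral => y _; rewrite /Phi /= -EFinM mulrC.
  - by move=> y _; rewrite lee_fin.
  - apply: measurable_funTS; apply/measurable_EFinP.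
    by apply: (measurableT_comp mgx (g := fun y : mR => (t, y))); exact: measurable_pair1.
rewrite (eq_integral (fun t => h%:E * \int[mu]_(y in I) (g x t y)%:E)%E); last by move=> t _; exact: JE.
rewrite ge0_integralZl_EFin; [|exact: mJ| | |exact: h0].
- apply: (@le_trans _ _ (h%:E * (`|2 * U x t0|)%:E)%E); last by apply: lee_wpmul2l => //; rewrite lee_fin.
  rewrite -EFinM lee_fin normrM ger0_norm //.
  have [u0|u0] := eqVneq (U x t0) 0.
    by rewrite /h u0 normr0 powR0 ?mulr0 // gt_eqF // (lt_trans ltr01).
  have -> : `|U x t0| `^ q = h * `|U x t0|.
    rewrite /h -[X in _ * X]powRr1 // -powRD; last by rewrite normr_eq0 u0 implybT.
    by rewrite subrK.
  by rewrite ler_wpM2l // ler_peMl // ler1n.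
- by move=> t _; apply: integral_ge0 => y _; rewrite lee_fin.
- apply: measurable_funTS.
  apply: (@measurable_int12 R _ mR I (fun z => (g x z.1 z.2)%:E)) => //.
    by apply/measurable_EFinP.
  by move=> z; rewrite lee_fin.
Qed.

Let N (t : R) : \bar R := 'N[mu]_(p%:E)[(fun x => (F x t)%:E)]%E.

Let mN : measurable_fun setT (N : mR -> \bar R).
Proof.
rewrite /N unlock; apply: (measurableT_comp (measurable_poweR _)).
apply: (@measurable_int21 R setT (fun z => `|(F z.1 z.2)%:E| `^ p)%E) => //.
  apply: (measurableT_comp (measurable_poweR _)); apply: measurableT_comp => //.
  by apply/measurable_EFinP.
by move=> z; exact: poweR_ge0.
Qed.

Let profile (t : mR) : mR :=
  (1 + t0 - t) * (expR (t0 - t) - 1) `^ (1 / rho) * (expR (t0 - t) + 1)^-1.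

Let mprofile : measurable_fun setT profile.
Proof.
have me : measurable_fun setT (fun t : mR => expR (t0 - t) : mR).
  by apply: continuous_measurable_fun; apply: cont_expR; apply: contD; [exact: cont_cst|apply: contN; exact: cont_id].
apply: measurable_funM; first apply: measurable_funM.
- exact: measurable_funB.
- apply: (measurableT_comp (measurable_powR _)); exact: measurable_funB.
- apply: continuous_measurable_fun; apply: contV.
    by move=> t; rewrite gt_eqF // addr_gt0 // expR_gt0.
  apply: contD; last exact: cont_cst.
  by apply: cont_expR; apply: contD; [exact: cont_cst|apply: contN; exact: cont_id].
Qed.

Let mw : measurable_fun setT (time_weight rho t0 : mR -> mR).
Proof. exact: measurable_funM. Qed.

(** With A the integral of |u|^q over [a, b], duality gives A <= A^{1-1/q} K Q. Cancelling the power
    of A requires 0 < A < +oo, and finiteness comes from the compact interval. Only u is restricted;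
    the norms of F are over the whole line. *)
Lemma truncated_Lp_Lq_estimate :
  ((\int[mu]_(x in D) (`|U x t0| `^ q)%:E) `^ q^-1 <=
   K%:E * \int[mu]_(t in J) ((time_weight rho t0 t)%:E * N t))%E.
Proof.
set Q := (\int[mu]_(t in J) _)%E.
have K0 : 0 <= K.
  by rewrite /K; apply: mulr_ge0 (powR_ge0 _ _); exact: mulr_ge0 (ltW C10).
have Q0 : (0 <= Q)%E.
  apply: integral_ge0 => t; rewrite /J /= in_itv /= => /andP[_ tt0].
  by rewrite mule_ge0 ?Lnorm_ge0 // lee_fin time_weight_ge0.
have q0 : q != 0 by rewrite gt_eqF // (lt_trans ltr01).
have qi0 : q^-1 != 0 by rewrite invr_eq0.
have mUq : measurable_fun setT (fun x : mR => `|U x t0| `^ q : mR).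
  by apply: (measurableT_comp (measurable_powR q)); exact: measurableT_comp.
have Afin : (\int[mu]_(x in D) (`|U x t0| `^ q)%:E < +oo)%E.
  have [c cab Hc] : exists2 c : R, c \in `[a, b]%R &
      forall x, x \in `[a, b]%R -> `|U x t0| <= `|U c t0|.
    apply: (@EVT_max _ (fun x => `|U x t0|)) => //; apply: continuous_subspaceT; apply: cont_norm.
    by apply: (jcont_comp (cd_U cdata)); [exact: cont_id|exact: cont_cst].
  apply: (@le_lt_trans _ _ (\int[mu]_(x in D) (cst (`|U c t0| `^ q)%:E) x)%E).
    apply: ge0_le_integral => //.
    - by apply: measurable_funTS; apply/measurable_EFinP.
    - move=> x xD; rewrite lee_fin ge0_ler_powR ?nnegrE //; first by rewrite ltW // (lt_trans ltr01).
      by apply: Hc; rewrite -inE; move: xD; rewrite /D inE.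
  rewrite integral_cst //= /D lebesgue_measure_itv /=.
  by case: ifPn => _; rewrite ?mule0 // -EFinB -EFinM ltry.
have A0 : (0 <= \int[mu]_(x in D) (`|U x t0| `^ q)%:E)%E.
  by apply: integral_ge0 => x _; rewrite lee_fin powR_ge0.
case AE : (\int[mu]_(x in D) (`|U x t0| `^ q)%:E)%E Afin A0 => [A| |] // _.
rewrite lee_fin le_eqVlt => /predU1P[A0|A0].
  by rewrite -A0 poweR0r // mule_ge0.
have AA : (\int[mu]_(x in D) (`|U x t0| `^ q)%:E <= A%:E)%E by rewrite AE.
pose A' := A `^ (1 - q^-1).
have A'0 : 0 < A' by exact: powR_gt0.
have key : (A%:E <= A'%:E * (K%:E * Q))%E.
  apply: (@le_trans _ _ (\int[mu]_(x in D) \int[mu]_(t in J) Jf (x, t))%E).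
    rewrite -AE; apply: ge0_le_integral => //.
    - by apply: measurable_funTS; apply/measurable_EFinP.
    - apply: measurable_funTS; exact: (measurable_int12 mJ mJf).
  (* Exchanging x and t here plays the part of Minkowski's inequality: each source time can then be
     estimated separately. *)
  rewrite -(tonelli_set12 mD mJ mJf Jf0) (tonelli_set21 mD mJ mJf Jf0).
  rewrite muleA -EFinM /Q.
  have mwN : measurable_fun J (fun t => (time_weight rho t0 t)%:E * N t)%E.
    apply: measurable_funTS; apply: emeasurable_funM => //.
    by apply/measurable_EFinP.
  have wN0 t : J t -> (0 <= (time_weight rho t0 t)%:E * N t)%E.
    rewrite /J /= in_itv /= => /andP[_ tt0].
    by rewrite mule_ge0 ?Lnorm_ge0 // lee_fin time_weight_ge0.
  have AK : 0 <= A' * K by rewrite mulr_ge0 // ltW.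
  rewrite -(ge0_integralZl_EFin _ mJ wN0 mwN AK).
  apply: ge0_le_integral => //.
  - by move=> t _; apply: integral_ge0 => x _; exact: Jf0.
  - by apply: measurable_funTS; exact: (measurable_int21 mD mJf).
  - by apply: emeasurable_funM => //; exact: measurable_cst.
  move=> t; rewrite /J /= in_itv /= => /andP[_ tt0].
  have pt := per_time_estimate rho1 rho2 p1' q1 hq C10 A0 tt0 cp0 bnd (mFt t) mU mD AA.
  apply: le_trans pt _.
  rewrite muleA -EFinM /N.
  by rewrite (_ : A' * K * _ = K * time_weight rho t0 t * A `^ (1 - q^-1)) //; rewrite -/A'; ring.
rewrite poweR_EFin.
have AE' : A = A' * A `^ q^-1.
  rewrite /A' -powRD; last by rewrite (gt_eqF A0) implybT.
  by rewrite subrK powRr1 // ltW.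
rewrite -(@lee_pmul2l _ A'%:E) // ?lte_fin // -EFinM -AE'.
exact: key.
Qed.

Lemma time_weight_integral :
  (\int[mu]_(t in J) ((time_weight rho t0 t)%:E * N t) =
   (expR (t0 * (1 - 1 / rho)))%:E * \int[mu]_(t in J) ((profile t)%:E * N t))%E.
Proof.
rewrite -ge0_integralZl_EFin ?expR_ge0 //.
- by apply: eq_integral => t _; rewrite muleA -EFinM.
- move=> t; rewrite /J /= in_itv /= => /andP[_ tt0].
  rewrite mule_ge0 ?Lnorm_ge0 // lee_fin -(pmulr_rge0 _ (expR_gt0 (t0 * (1 - 1 / rho)))).
  exact: time_weight_ge0.
- by apply: measurable_funTS; apply: emeasurable_funM => //; apply/measurable_EFinP.
Qed.

End LpLqEstimate.

(** * Passage to the whole line and to extended exponents *)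

Section Conclusion.
Context {R : realType}.
Local Notation mu := (@lebesgue_measure R).

Let poweR_le (r : R) (x y : \bar R) :
  0 <= r -> (0 <= x)%E -> (x <= y)%E -> (x `^ r <= y `^ r)%E.
Proof.
move=> r0 x0 xy; apply: gt0_ler_poweR => //; rewrite in_itv /= leey andbT //.
exact: le_trans xy.
Qed.

(** Monotone convergence along [-n, n]. The bound B may be +oo, so it is raised to the power q and
    back within the extended reals. *)
Lemma Lnorm_le_truncated (v : R -> R) (q : R) (B : \bar R) :
  continuous v -> 0 < q ->
  (forall n : nat, ((\int[mu]_(x in `[(- n%:R)%R, n%:R%R]) (`|v x| `^ q)%:E) `^ q^-1 <= B)%E) ->
  ('N[mu]_(q%:E) [(fun x => (v x)%:E)] <= B)%E.
Proof.
move=> cv q0 H.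
have qi0 : 0 <= q^-1 by rewrite invr_ge0 ltW.
have B0 : (0 <= B)%E by apply: le_trans (H 0%N); exact: poweR_ge0.
have mv : measurable_fun setT (fun x => (`|v x| `^ q)%:E).
  apply/measurable_EFinP; apply: (measurableT_comp (measurable_powR q)).
  by apply: measurableT_comp => //; exact: continuous_measurable_fun.
have intge0 (A : set R) : (0 <= \int[mu]_(x in A) (`|v x| `^ q)%:E)%E.
  by apply: integral_ge0 => x _; rewrite lee_fin powR_ge0.
have H' n : (\int[mu]_(x in `[(- n%:R)%R, n%:R%R]) (`|v x| `^ q)%:E <= B `^ q)%E.
  have := poweR_le (ltW q0) (poweR_ge0 _ _) (H n).
  by rewrite -poweRrM mulVf ?gt_eqF // poweRe1.
pose F (n : nat) : set (measurableTypeR R) := `[- n%:R, n%:R]%classic.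
have UT : \bigcup_n F n = setT.
  apply/seteqP; split => // x _; exists (Num.trunc `|x|).+1 => //=.
  by rewrite /F /= in_itv /= -ler_norml ltW // truncnS_gt.
have int : (\int[mu]_x (`|v x| `^ q)%:E <= B `^ q)%E.
  rewrite -UT.
  have cvn : (\int[mu]_(x in F n) (`|v x| `^ q)%:E)%E @[n --> \oo] -->
     (\int[mu]_(x in \bigcup_n F n) (`|v x| `^ q)%:E)%E.
    apply: ge0_nondecreasing_set_cvg_integral.
    - move=> n m nm; apply/subsetPset => x; rewrite /F /= !in_itv /= -!ler_norml.
      by move=> /le_trans; apply; rewrite ler_nat.
    - by move=> n; exact: measurable_itv.
    - by move=> n; exact: measurable_funTS.
    - by move=> n x _; rewrite lee_fin powR_ge0.
  rewrite -(cvg_lim _ cvn) //; apply: lime_le; first by apply/cvg_ex; eexists; exact: cvn.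
  by apply: nearW => n; exact: H'.
rewrite unlock.
have -> : (\int[mu]_x `|(v x)%:E| `^ q = \int[mu]_x (`|v x| `^ q)%:E)%E.
  by apply: eq_integral => x _; rewrite abse_EFin poweR_EFin.
have := poweR_le qi0 (intge0 setT) int.
by rewrite -poweRrM divff ?gt_eqF // poweRe1.
Qed.

(** Whether rho' is finite or +oo, its inverse is the real number 1 - 1/rho. The condition p < rho'
    makes 1/q positive, and 1/q <= 1/p < 1 gives q > 1. *)
Lemma conjugate_exponents (rho p q : R) (rho' : \bar R) :
  1 <= rho -> (rho%:E^-1 + rho'^-1 = 1)%E -> 1 < p -> (p%:E < rho')%E ->
  (q%:E^-1 = p%:E^-1 - rho'^-1)%E ->
  1 < q /\ q^-1 = p^-1 - (1 - rho^-1).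
Proof.
move=> rho1 hr p1 pr hq.
have rho0 : rho != 0 by rewrite gt_eqF // (lt_le_trans ltr01).
have pp : 0 < p by rewrite (lt_trans ltr01).
have p0 : p != 0 by rewrite gt_eqF.
have [r Er rp] : exists2 r : R, (rho'^-1 = r%:E)%E & r < p^-1.
  case: rho' pr {hr hq} => [s| |] //.
    rewrite lte_fin => ps; have s0 : 0 < s by exact: lt_trans ps.
    by exists s^-1; rewrite ?inver ?gt_eqF // ltf_pV2.
  by move=> _; exists 0; rewrite ?inver ?invr_gt0.
have r1 : r = 1 - rho^-1.
  by move: hr; rewrite Er inver (negbTE rho0) -EFinD => -[] <-; rewrite addrC addKr.
move: hq; rewrite Er !inver (negbTE p0) -EFinB r1.
(* In the extended reals the inverse of 0 is +oo, so q = 0 contradicts the finite right side. *)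
case: eqP => // /eqP q0 [hq]; split=> //.
have qi0 : 0 < q^-1 by rewrite hq -r1 subr_gt0.
have q00 : 0 < q by rewrite -invr_gt0.
rewrite -(invf_lt1 q00) hq; apply: (@le_lt_trans _ _ p^-1); last by rewrite invf_lt1.
by rewrite gerBl subr_ge0 invf_le1 // (lt_le_trans ltr01).
Qed.
End Conclusion.

Theorem theorem7p1 (R : realType) (M : R) (hM : 0 <= M)
    (rho : R) (rho' : \bar R) (p q : R)
    (hrho1 : 1 <= rho) (hrho2 : rho < 2)
    (hrho' : (rho%:E^-1 + rho'^-1 = 1)%E)
    (hp1 : 1 < p) (hp2 : (p%:E < rho')%E)
    (hq : (q%:E^-1 = p%:E^-1 - rho'^-1)%E) :
  exists CM : R, forall f : R -> R -> R,
    Ck_half_plane 2 f ->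
    (forall t, 0 <= t -> smooth_compact_support (f^~ t)) ->
    forall u : R -> R -> R, is_cauchy_solution M f u ->
    forall t : R, 0 < t ->
    ('N[lebesgue_measure]_(q%:E) [(fun x => (u x t)%:E)] <=
       CM%:E * (expR (t * (1 - 1 / rho)))%:E *
       \int[lebesgue_measure]_(b in `[0%R, t])
         (((1 + t - b) * (expR (t - b) - 1) `^ (1 / rho)
             * (expR (t - b) + 1)^-1)%:E
          * 'N[lebesgue_measure]_(p%:E) [(fun x => (f x b)%:E)]))%E.
Proof.
have [q1 qE] := conjugate_exponents hrho1 hrho' hp1 hp2 hq.
have l0 : 0 <= M ^+ 2 + 4^-1 by nonneg.
have [p0 [p1 [p2 [cp0 cp1 cp2 p01 legp]]]] := legendre_exists l0.
have [C C0 bnd] := legendre_bound cp0 legp.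
(* Strict positivity matters when a norm of f is infinite: the product with a zero constant would be
   0 and not +oo. *)
have C10 : 0 < C + 1 by rewrite ltr_wpDl.
have bnd1 Z : 1 <= Z -> `|p0 Z| * Num.sqrt Z <= (C + 1) * (1 + ln Z).
  move=> Z1; apply: le_trans (bnd Z Z1) _; rewrite ler_wpM2r ?lerDl //.
  by rewrite addr_ge0 // ln_ge0.
(* The constant, fixed before f, is found by unification at the end: 4 (C + 1) (4 / (1 -
   rho/2))^{1/rho}, which depends only on M and rho. *)
eexists => f cf _ u su t t0.
have [Ux [Ut [Uxx [Utx [Utt cdata]]]]] := cauchy_data_exists cf su.
have -> : (fun x => (u x t)%:E) = (fun x => (trunc u x t)%:E).
  by apply/funext => x; rewrite truncE // ltW.
apply: Lnorm_le_truncated.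
- by apply: (jcont_comp (cd_U cdata)); [exact: cont_id|exact: cont_cst].
- by rewrite (lt_trans ltr01).
move=> n.
have nn : - n%:R <= n%:R :> R by rewrite (@le_trans _ _ 0) ?oppr_le0.
have := truncated_Lp_Lq_estimate cp0 cp1 cp2 p01 legp C10 hrho1 hrho2 hp1 q1 qE bnd1 cdata t0 nn.
rewrite (time_weight_integral _ _ cdata) => /le_trans; apply.
rewrite muleA le_eqVlt; apply/orP; left; apply/eqP; congr (_ * _)%E.
apply: eq_integral => b; rewrite inE /= in_itv /= => /andP[b0 _].
congr (_ * 'N[_]_ _ [_])%E.
by apply/funext => x; rewrite truncE.
Qed.
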